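(* Let $V$ be a countable vertex set and let $(c_t)_{t\in[0,\infty)}$ be a deterministic family of symmetric conductances on $V$, non-decreasing in $t$, with limit $c_\infty$ (i.e. $c_t(u,v)\uparrow c_\infty(u,v)$ as $t\to\infty$ for all $u,v$), where $\pi_\infty(v)=\sum_z c_\infty(v,z)<\infty$ for every $v\in V$. Let $(X_t)_{t\ge0}$ be the continuous-time random walk in the changing environment $(c_t)_{t\ge0}$, started at an arbitrary vertex, with explosion time $\zeta\in[0,\infty]$. If the random walk on $(V,c_0)$ is irreducible and transient, then $(X_t)$ is transient, in the sense that for every $v\in V$ the expected number of visits to $v$ (before $\zeta$) is finite and the expected local time $$\mathbb{E}\left[\int_0^{\zeta}\mathbf{1}_{\{X_t=v\}}\,dt\right]$$ is finite.
   Context: Conductances are symmetric functions $c:V\times V\to[0,\infty)$ with $c(v,v)=0$ (no loops, as loops do not affect the dynamics) and finite total conductance $\pi(y)=\sum_z c(y,z)$ at every vertex; vertices may have infinitely many neighbors. The continuous-time random walk in the changing environment $(c_t)_{t\ge0}$: each edge $e$ carries an independent Poisson clock with (time-dependent) rate $c_t(e)$ at time $t$; when a clock rings and the walk is at an endpoint of that edge, the walk traverses the edge. Thus at time $t$ the walk at $y$ jumps to $z$ at rate $c_t(y,z)$. If $T_n$ is the time of the $n$-th jump, the explosion time is $\zeta=\lim_{n\to\infty}T_n\in[0,\infty]$ (with $\zeta=\infty$ if there are only finitely many jumps). The random walk on the fixed network $(V,c_0)$ jumps from $y$ to $z$ with probability $c_0(y,z)/\pi_0(y)$. *)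

(* Defs.v *)
From mathcomp Require Import all_boot all_order all_algebra finmap.
From mathcomp Require Import all_classical all_reals all_analysis.
From mathcomp Require Import measurable_realfun.
Import Order.TTheory GRing.Theory Num.Theory.
Import numFieldNormedType.Exports.

Set Implicit Arguments.
Unset Strict Implicit.
Unset Printing Implicit Defensive.

Local Open Scope classical_set_scope.
Local Open Scope ring_scope.
Local Open Scope ereal_scope.

Section networks.
Context {R : realType} {V : countType}.
Implicit Types c : V -> V -> R.

Definition total_conductance c (y : V) : \bar R :=
  \esum_(z in [set: V]) (c y z)%:E.

Definition conductances c : Prop :=
  [/\ forall u v, (0 <= c u v)%R,
      forall u v, c u v = c v u,
      forall v, c v v = 0%R
    & forall y, total_conductance c y < +oo].

(* The jump probability c y z / pi y.  At a vertex without edges this quotient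
   makes no sense and the walk is taken to stay put; in an irreducible network
   this only concerns the one-vertex network, which is thus recurrent. *)
Definition rw_step c (y z : V) : \bar R :=
  if total_conductance c y == 0 then (y == z)%:R%:E
  else (c y z / fine (total_conductance c y))%:E.

Fixpoint rw_nstep c (n : nat) (x y : V) : \bar R :=
  if n is m.+1 then \esum_(z in [set: V]) (rw_step c x z * rw_nstep c m z y)
  else (x == y)%:R%:E.

Definition rw_irreducible c : Prop :=
  forall x y, exists n, 0 < rw_nstep c n x y.

(* The sum is the expected number of visits to v of the walk started at v. *)
Definition rw_transient c : Prop :=
  forall v, \sum_(0 <= n <oo) rw_nstep c n v v < +oo.

End networks.

Section independence.
Context d (Omega : measurableType d) (R : realType) (P : probability Omega R).

Definition mutually_independent (I : choiceType) (D : set I)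
    (F : I -> set (set Omega)) : Prop :=
  (forall i, D i -> F i `<=` measurable) /\
  forall (J : {fset I}) (A : I -> set Omega), [set` J] `<=` D ->
    (forall i, i \in J -> F i (A i)) ->
    P (\bigcap_(i in [set` J]) A i) = \prod_(i <- J) P (A i).

End independence.

Section poisson_clocks.
Context {R : realType} d (Omega : measurableType d) (P : probability Omega R).

(* A clock is given by its random set of ringing times. *)
Implicit Type S : Omega -> set R.

Definition nb_rings S (a b : R) (w : Omega) : \bar R :=
  counting (S w `&` `]a, b]%classic).

Definition sigma_rings S (a b : R) : set (set Omega) :=
  preimage_set_system setT (nb_rings S a b) (@measurable _ (\bar R)).

Definition sigma_clock S : set (set Omega) :=
  <<s [set A | exists a b : R, (0 <= a <= b)%R /\ sigma_rings S a b A] >>.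

(* The library's poisson_pmf is 1 for every k at rate 0, where the Poisson
   distribution must be the Dirac mass at 0. *)
Definition poisson_mass (r : R) (k : nat) : R :=
  (r ^+ k / k`!%:R * expR (- r))%R.

Definition poisson_clock (rate : R -> R) S : Prop :=
  [/\ forall a b : R, (0 <= a <= b)%R ->
        measurable_fun [set: Omega] (nb_rings S a b),
      forall (a b : R) (k : nat), (0 <= a <= b)%R ->
        P [set w | nb_rings S a b w = k%:R%:E] =
        (poisson_mass (\int[lebesgue_measure]_(t in `]a, b]) rate t)%R k)%:E
    & forall t : nat -> R, (0 <= t 0%N)%R ->
        {homo t : m n / (m <= n)%N >-> (m <= n)%R} ->
        mutually_independent P [set: nat]
          (fun i => sigma_rings S (t i) (t i.+1))].

(* clock u v and clock v u are the same clock, that of the edge {u, v};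
   independence is over the edges, each represented by the pair (u, v)
   whose first component comes first in the enumeration pickle of V. *)
Definition edge_clocks (V : countType) (c : R -> V -> V -> R)
    (clock : V -> V -> Omega -> set R) : Prop :=
  [/\ forall u v, clock u v = clock v u,
      forall u v, u != v -> poisson_clock (fun t => c t u v) (clock u v)
    & mutually_independent P [set e : V * V | (choice.pickle e.1 < choice.pickle e.2)%N]
        (fun e => sigma_clock (clock e.1 e.2))].

End poisson_clocks.

Section walk.
Context {R : realType} {V : countType}.

(* The rings, after time s, of the clocks of the edges at y. *)
Definition rings_after (ring : V -> V -> set R) (y : V) (s : \bar R) : set R :=
  [set t | s < t%:E /\ exists2 z, z != y & ring y z t].

(* Y n is the position after the n-th jump and T n the time of that jump.
   T n = +oo means that there are fewer than n jumps; Y n is then irrelevant. *)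
Definition driven_by (ring : V -> V -> set R) (x : V)
    (Y : nat -> V) (T : nat -> \bar R) : Prop :=
  [/\ Y 0%N = x, T 0%N = 0
    & forall n,
        (rings_after ring (Y n) (T n) = set0 /\ T n.+1 = +oo) \/
        (exists t : R,
          [/\ T n.+1 = t%:E, T n < t%:E,
              Y n.+1 != Y n, ring (Y n) (Y n.+1) t
            & forall s, rings_after ring (Y n) (T n) s -> (t <= s)%R])].

Definition explosion_time (T : nat -> \bar R) : \bar R := limn T.

(* The position at time t, None from the explosion time on. *)
Definition position (Y : nat -> V) (T : nat -> \bar R) (t : R) : option V :=
  xget None [set o | exists n, T n <= t%:E < T n.+1 /\ o = Some (Y n)].

Definition nb_visits (Y : nat -> V) (T : nat -> \bar R) (v : V) : \bar R :=
  counting [set n | T n < explosion_time T /\ Y n = v].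

Definition local_time (Y : nat -> V) (T : nat -> \bar R) (v : V) : \bar R :=
  \int[lebesgue_measure]_(t in [set t : R | 0 <= t%:E < explosion_time T])
    (\1_[set s | position Y T s = Some v] t)%:E.

(* The random variables Y n, T n describe the random walk started at x in the
   environment c, given by the graphical construction with Poisson clocks. *)
Definition rw_changing_environment d (Omega : measurableType d)
    (P : probability Omega R) (c : R -> V -> V -> R) (x : V)
    (Y : nat -> Omega -> V) (T : nat -> Omega -> \bar R) : Prop :=
  [/\ forall n v, measurable [set w | Y n w = v],
      forall n, measurable_fun [set: Omega] (T n)
    & exists clock : V -> V -> Omega -> set R,
        edge_clocks P c clock /\
        {ae P, forall w, driven_by (fun u v => clock u v w) x
                           (Y ^~ w) (T ^~ w)}].

End walk.

(* Main.v *)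
(* The generators L_t of the walk are all symmetric with respect to the counting
   measure, so energy methods apply.  Let u_t be the law of the walk killed
   outside a finite set B, G_t the inverse of -L_t, and w_t = u_t + d_v.  The
   conductances increase, so G_t decreases as a quadratic form and
     d/dt (w_t, G_t w_t) <= - 2 (u_t, w_t) <= - 2 u_t(v),
   whence the integral of u_t(v) is at most (w_0, G_0 w_0) / 2, which is bounded
   uniformly in B by the transience of c_0.  The argument is run in discrete
   time: on a grid of mesh h, the events "the walk is at z at time k h and has
   not left B" are contained, up to collisions (two rings in one cell of the
   grid) of total probability O(h), in events that are Boolean combinations of
   "no ring on this edge in this cell", and whose probabilities satisfy
   u_{k+1} <= (1 - A_k) u_k + O(h^2).  Departures from v and time spent at v are
   read off the same events; finally h tends to 0 and B increases to V. *)
Require Import Defs.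
From mathcomp Require Import all_boot all_order all_algebra finmap.
From mathcomp Require Import all_classical all_reals all_analysis.
From mathcomp Require Import measurable_realfun.
From mathcomp Require Import ring lra.
Import Order.TTheory GRing.Theory Num.Theory.
Import numFieldNormedType.Exports.

Set Implicit Arguments.
Unset Strict Implicit.
Unset Printing Implicit Defensive.

Local Open Scope classical_set_scope.
Local Open Scope ring_scope.

(** * Dirichlet forms of finite networks *)

(** A vertex may have infinitely many neighbours, while a cell of the grid is analysed only for
    finitely many clocks. Only the edges inside a finite set B ++ B' are therefore watched: a ring
    on an edge from B to B' kills the walk, one on an edge leaving B ++ B' goes unnoticed. This only
    enlarges the events, but it removes killing, that is, energy. For f supported in B the lost
    energy is governed by the tail of c_0 at the vertices of B, and B' is chosen to keep it below
    half of the killed energy; hence the factor 2 in [resistance]. The operator G_t is never formed: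
    (w, G w) is the supremum over f of 2 (w, f) - E(f, f), and the test function f is the sum of the
    later u_k, so only Dirichlet forms have to be compared in time. Likewise the transience of c_0
    enters as f(v)^2 <= C_v E(f, f) for finitely supported f, with C_v independent of B. The walk is
    never shown to be Markov: independence concerns the clocks alone, and the path is compared with
    their events pointwise. B, the horizon N and then B' are fixed while the mesh tends to 0;
    afterwards B and N grow together. *)

Section dirichlet.
Context {R : realFieldType} {V : eqType}.
Variable W : seq V.
Implicit Types (m : V -> V -> R) (f g u : V -> R).

Definition dirichlet m f g : R :=
  (\sum_(y <- W) \sum_(z <- W) m y z * (f y - f z) * (g y - g z)) / 2.

(** With this sign the operator is nonnegative for symmetric nonnegative [m], and
    [f - laplacian m f] is one step of the heat flow. *)
Definition laplacian m f (z : V) : R := \sum_(y <- W) m z y * (f z - f y).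

Lemma dirichlet_laplacian m f g : (forall y z, m y z = m z y) ->
  \sum_(z <- W) laplacian m f z * g z = dirichlet m f g.
Proof.
move=> ms; rewrite /dirichlet.
have -> : \sum_(y <- W) \sum_(z <- W) m y z * (f y - f z) * (g y - g z) =
    \sum_(y <- W) \sum_(z <- W) m y z * (f y - f z) * g y -
    \sum_(y <- W) \sum_(z <- W) m y z * (f y - f z) * g z.
  rewrite -sumrB; apply: eq_bigr => y _.
  by rewrite -sumrB; apply: eq_bigr => z _; rewrite mulrBr.
rewrite [X in _ - X]exchange_big /=.
have -> : \sum_(j <- W) \sum_(i <- W) m i j * (f i - f j) * g j =
   - \sum_(y <- W) \sum_(z <- W) m y z * (f y - f z) * g y.
  rewrite -sumrN; apply: eq_bigr => y _; rewrite -sumrN.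
  by apply: eq_bigr => z _; rewrite ms; ring.
rewrite opprK -mulr2n -[X in _ = X / 2]mulr_natr mulfK ?pnatr_eq0 //.
by apply: eq_bigr => z _; rewrite mulr_suml.
Qed.

Lemma dirichletD m f g :
  dirichlet m (f \+ g) (f \+ g) =
  dirichlet m f f + 2 * dirichlet m g f + dirichlet m g g.
Proof.
have <- : dirichlet m f f + (dirichlet m g f *+ 2) + dirichlet m g g =
  dirichlet m f f + 2 * dirichlet m g f + dirichlet m g g.
  by rewrite -(mulr_natl (dirichlet m g f) 2).
rewrite /dirichlet -mulrnAl -!mulrDl; congr (_ / _).
rewrite mulr2n -!big_split; apply: eq_bigr => y _.
by rewrite -!big_split; apply: eq_bigr => z _ /=; ring.
Qed.

Lemma le_dirichlet m1 m2 f : (forall y z, m1 y z <= m2 y z) ->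
  dirichlet m1 f f <= dirichlet m2 f f.
Proof.
move=> m12; rewrite ler_pM2r ?invr_gt0 ?ltr0n //.
apply: ler_sum => y _; apply: ler_sum => z _.
by rewrite -!mulrA ler_wpM2r // -expr2 sqr_ge0.
Qed.

Lemma dirichletZ m h f :
  dirichlet (fun y z => h * m y z) f f = h * dirichlet m f f.
Proof.
rewrite /dirichlet mulrA mulr_sumr; congr (_ / _); apply: eq_bigr => y _.
by rewrite mulr_sumr; apply: eq_bigr => z _; rewrite !mulrA.
Qed.

(** From (a - b)^2 <= 2 a^2 + 2 b^2. The constant 2 is exactly what [energy_step] can afford:
    passing from f to f + u gains 2 (u, u) and costs E(u, u). The condition on row sums is the
    stability condition of the explicit time step. *)
Lemma dirichlet_le_sum_sqr m f : (forall y z, m y z = m z y) ->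
  (forall y z, 0 <= m y z) ->
  (forall z, z \in W -> \sum_(y <- W) m z y <= 1) ->
  dirichlet m f f <= 2 * \sum_(z <- W) f z ^+ 2.
Proof.
move=> ms m0 m1.
have sum_le : \sum_(y <- W) \sum_(z <- W) m y z * f y ^+ 2 <= \sum_(z <- W) f z ^+ 2.
  rewrite !big_seq; apply: ler_sum => y yW; rewrite -mulr_suml.
  by rewrite ler_piMl ?sqr_ge0 // m1.
have sum_le' : \sum_(y <- W) \sum_(z <- W) m y z * f z ^+ 2 <= \sum_(z <- W) f z ^+ 2.
  rewrite exchange_big /= !big_seq; apply: ler_sum => y yW; rewrite -mulr_suml.
  rewrite ler_piMl ?sqr_ge0 // (le_trans _ (m1 _ yW)) //.
  by apply: ler_sum => z _; rewrite ms.
rewrite /dirichlet ler_pdivrMr ?ltr0n //.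
apply: (@le_trans _ _ (\sum_(y <- W) \sum_(z <- W)
    (2 * (m y z * f y ^+ 2) + 2 * (m y z * f z ^+ 2)))).
  apply: ler_sum => y _; apply: ler_sum => z _.
  have := sqr_ge0 (f y + f z); have := m0 y z; nra.
have -> : \sum_(y <- W) \sum_(z <- W) (2 * (m y z * f y ^+ 2) + 2 * (m y z * f z ^+ 2)) =
  2 * (\sum_(y <- W) \sum_(z <- W) m y z * f y ^+ 2) +
  2 * \sum_(y <- W) \sum_(z <- W) m y z * f z ^+ 2.
  rewrite !mulr_sumr -big_split; apply: eq_bigr => y _ /=.
  by rewrite !mulr_sumr -big_split.
lra.
Qed.

(* One step of the Lyapunov argument: in terms of the inverse G of the
   Laplacian, the two sides below are values of the concave functionals whose
   suprema over f are (u' + d_v, G' (u' + d_v)) and (u + d_v, G (u + d_v)). *)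
Lemma energy_step m m' u u' f (v : V) (rho : R) :
  (forall y z, m y z = m z y) -> (forall y z, 0 <= m y z) ->
  (forall z, z \in W -> \sum_(y <- W) m z y <= 1) ->
  (forall y z, m y z <= m' y z) ->
  (forall z, 0 <= f z) ->
  (forall z, z \in W -> f z != 0 -> u' z <= u z - laplacian m u z + rho) ->
  2 * (\sum_(z <- W) u' z * f z) + 2 * f v - dirichlet m' f f <=
  2 * (\sum_(z <- W) u z * (f \+ u) z) + 2 * (f \+ u) v
   - dirichlet m (f \+ u) (f \+ u) - 2 * u v + 2 * rho * \sum_(z <- W) f z.
Proof.
move=> ms m0 m1 mm' f0 step.
have h1 : \sum_(z <- W) u' z * f z <=
    \sum_(z <- W) u z * f z - dirichlet m u f + rho * \sum_(z <- W) f z.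
  rewrite -dirichlet_laplacian // mulr_sumr -sumrB -big_split /= !big_seq.
  apply: ler_sum => z zW.
  have [->|fz] := eqVneq (f z) 0; first by rewrite !mulr0 subr0 addr0.
  by rewrite -mulrBl -mulrDl ler_wpM2r // step.
have h2 := @le_dirichlet m m' f mm'.
have h3 := @dirichlet_le_sum_sqr m u ms m0 m1.
rewrite dirichletD /=.
have -> : \sum_(z <- W) u z * (f z + u z) = \sum_(z <- W) u z * f z + \sum_(z <- W) u z ^+ 2.
  by rewrite -big_split; apply: eq_bigr => z _ /=; rewrite mulrDr expr2.
lra.
Qed.

(** Iterates [energy_step] with the sum of the [u j], j >= k, as test function at time k: it is 0 at
    the end and F at the start, and each step releases one term 2 u_k(v). The recursion is asked
    only where some [u j] is nonzero, since every test function vanishes elsewhere. *)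
Lemma energy_sum (m : nat -> V -> V -> R) (u : nat -> V -> R) (v : V) (rho : R) n :
  (forall k y z, m k y z = m k z y) -> (forall k y z, 0 <= m k y z) ->
  (forall k z, z \in W -> \sum_(y <- W) m k z y <= 1) ->
  (forall k y z, m k y z <= m k.+1 y z) ->
  (forall k z, 0 <= u k z) -> 0 <= rho ->
  (forall k z, z \in W -> (exists j, u j z != 0) ->
    u k.+1 z <= u k z - laplacian (m k) (u k) z + rho) ->
  let F z := \sum_(j < n) u j z in
  2 * (\sum_(j < n) u j v) <=
  2 * (\sum_(z <- W) u 0%N z * F z) + 2 * F v - dirichlet (m 0%N) F F
    + 2 * rho * n%:R * \sum_(z <- W) F z.
Proof.
move=> + + + + + rho0; elim: n m u => [|n IH] m u ms m0 m1 mn u0 step /=.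
  have E0 : dirichlet (m 0%N) (fun z => \sum_(j < 0) u j z) (fun z => \sum_(j < 0) u j z) = 0.
    rewrite /dirichlet big1 ?mul0r // => y _; rewrite big1 // => z _.
    by rewrite !big_ord0 subrr mulr0.
  rewrite E0 !big_ord0 !mulr0 mul0r !addr0 subr0 big1 ?mulr0 //.
  by move=> z _; rewrite big_ord0 mulr0.
pose F' z := \sum_(j < n) u j.+1 z.
have FE z : \sum_(j < n.+1) u j z = (F' \+ u 0%N) z.
  by rewrite big_ord_recl addrC.
have F'0 z : 0 <= F' z by apply: sumr_ge0 => *; exact: u0.
have {IH} := IH (fun k => m k.+1) (fun k => u k.+1) (fun k => ms _) (fun k => m0 _)
  (fun k => m1 _) (fun k => mn _) (fun k => u0 _).
rewrite -/F' => IH.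
have {}IH := IH (fun k z zW ex => step k.+1 z zW
  (let: ex_intro j p := ex in ex_intro _ j.+1 p)).
have := @energy_step (m 0%N) (m 1%N) (u 0%N) (u 1%N) F' v rho (ms _) (m0 _) (m1 _)
  (mn _) F'0.
move=> /(_ _)/wrap[|{}step].
  move=> z zW Fz; apply: step => //.
  have [[j uj]|/forallNP uj] := pselect (exists j, u j z != 0); first by exists j.
  move: Fz; rewrite /F' big1 ?eqxx // => j _.
  by apply/eqP/negPn/negP; exact: uj.
rewrite big_ord_recl /= mulrDr.
under [X in _ <= 2 * X + _ - _ + _]eq_bigr do rewrite FE.
rewrite (_ : (fun z => \sum_(j < n.+1) u j z) = F' \+ u 0%N); last first.
  by apply/funext => z; rewrite FE.
have FF : \sum_(z <- W) F' z <= \sum_(z <- W) \sum_(j < n.+1) u j z.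
  apply: ler_sum => z _; rewrite FE /= lerDl; exact: u0.
have FF0 : 0 <= \sum_(z <- W) F' z by apply: sumr_ge0 => *; exact: F'0.
rewrite -/(F' v) in IH.
rewrite -natr1.
have : rho * n%:R * (\sum_(z <- W) F' z) <= rho * n%:R * \sum_(z <- W) \sum_(j < n.+1) u j z.
  by rewrite ler_wpM2l // mulr_ge0.
have : rho * (\sum_(z <- W) F' z) <= rho * \sum_(z <- W) \sum_(j < n.+1) u j z.
  by rewrite ler_wpM2l.
move: IH step => /=.
set a := \sum_(z <- W) F' z; set b := \sum_(z <- W) \sum_(j < _) _.
rewrite -/(F' v).
lra.
Qed.

End dirichlet.

(** * Transience and the Green function *)

Lemma sum_le_esum {R : realType} {T : choiceType} (s : seq T) (a : T -> \bar R) :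
  uniq s -> (\sum_(i <- s) a i <= \esum_(i in [set: T]) a i)%E.
Proof.
move=> us; apply: esum_ge; exists [set` s].
  by split=> //; exact: finite_seq.
by rewrite fsbig_seq.
Qed.

Lemma esum_le_sum {R : realType} {T : choiceType} (a : T -> \bar R) (b : \bar R) :
  (forall s, uniq s -> \sum_(i <- s) a i <= b)%E ->
  (\esum_(i in [set: T]) a i <= b)%E.
Proof.
move=> sb; apply: ge_ereal_sup => _ [X [finX _] <-].
by rewrite fsbig_finite //= sb.
Qed.

Section total_conductance.
Context {R : realType} {V : countType}.
Variable c : V -> V -> R.
Hypothesis c_cond : conductances c.
Implicit Types (x y z v : V) (f g : V -> R).

Let c0 y z : 0 <= c y z. Proof. by case: c_cond. Qed.
Let cs y z : c y z = c z y. Proof. by case: c_cond. Qed.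

Definition vertex_weight v : R := fine (total_conductance c v).
Local Notation pi := vertex_weight.

Lemma total_conductance_ge0 y : (0 <= total_conductance c y)%E.
Proof. by apply: esum_ge0 => z _; rewrite lee_fin. Qed.

Lemma vertex_weightE y : total_conductance c y = (pi y)%:E.
Proof.
rewrite /pi fineK // ge0_fin_numE; last exact: total_conductance_ge0.
by case: c_cond.
Qed.

Lemma sum_le_vertex_weight (s : seq V) y : uniq s -> \sum_(z <- s) c y z <= pi y.
Proof.
by move=> us; rewrite -lee_fin -vertex_weightE -sumEFin; exact: sum_le_esum.
Qed.

Lemma exists_finite_vertex_weight (B : seq V) (e : R) : 0 < e -> uniq B ->
  exists2 B', uniq (B ++ B') &
    forall y, y \in B -> pi y <= \sum_(z <- B ++ B') c y z + e.
Proof.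
move=> e0 uB.
have one y : exists s : seq V, pi y <= \sum_(z <- undup s) c y z + e.
  apply: contrapT => /forallNP h.
  have : (total_conductance c y <= (pi y - e)%:E)%E.
    apply: esum_le_sum => s us; rewrite sumEFin lee_fin.
    have /negP := h s; rewrite -ltNge undup_id // => /ltW; lra.
  by rewrite vertex_weightE lee_fin; lra.
have [s hs] := choice one.
exists [seq z <- undup (flatten [seq s y | y <- B]) | z \notin B].
  rewrite cat_uniq uB filter_uniq ?undup_uniq // andbT -all_predC.
  by apply/allP => z; rewrite mem_filter => /andP[].
set B' := [seq _ <- _ | _] => y yB; apply: (le_trans (hs y)); rewrite lerD2r.
have uBB : uniq (B ++ B').
  rewrite cat_uniq uB filter_uniq ?undup_uniq // andbT -all_predC.
  by apply/allP => z; rewrite mem_filter => /andP[].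
have sub : {subset undup (s y) <= B ++ B'}.
  move=> z; rewrite mem_undup => zs; rewrite mem_cat mem_filter mem_undup.
  case: (z \in B) => //=; apply/flattenP; exists (s y) => //.
  exact: map_f.
rewrite [X in _ <= X](bigID (mem (undup (s y)))) /=.
rewrite -[X in _ <= X + _]big_filter [X in _ <= X + _](perm_big (undup (s y))) /=.
  by rewrite lerDl sumr_ge0.
apply: uniq_perm; rewrite ?filter_uniq ?undup_uniq // => z.
by rewrite mem_filter; case: (boolP (z \in undup _)) => //= /sub.
Qed.

Section transient.
Hypothesis c_trans : rw_transient c.

Lemma rw_nstep_ge0 n x y : (0 <= rw_nstep c n x y)%E.
Proof.
elim: n x => [|n IH] x /=; first by rewrite lee_fin ler0n.
apply: esum_ge0 => z _; apply: mule_ge0 => //; rewrite /rw_step.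
case: ifP => _; rewrite lee_fin ?ler0n // divr_ge0 //.
exact/fine_ge0/total_conductance_ge0.
Qed.

Definition green v : R := fine (\sum_(0 <= n <oo) rw_nstep c n v v)%E.

Lemma sum_rw_nstep_le_green v n :
  (\sum_(0 <= k < n) rw_nstep c k v v <= (green v)%:E)%E.
Proof.
rewrite /green fineK.
  by apply: nneseries_lim_ge => k _ _; exact: rw_nstep_ge0.
rewrite ge0_fin_numE //; apply: nneseries_ge0 => k _ _; exact: rw_nstep_ge0.
Qed.

(** By the convention in [rw_step], an isolated vertex is absorbing, so the number of its visits
    would be infinite, against transience. *)
Lemma vertex_weight_gt0 v : 0 < pi v.
Proof.
rewrite lt_neqAle; apply/andP; split; last exact/fine_ge0/total_conductance_ge0.
apply/negP => /eqP p0.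
have stay n : (1 <= rw_nstep c n v v)%E.
  elim: n => [|n IH] /=; first by rewrite eqxx.
  apply: le_trans IH _; apply: le_trans (sum_le_esum (s := [:: v]) _ _) => //.
  by rewrite big_seq1 /rw_step vertex_weightE -p0 !eqxx mul1e.
have /(_ (Num.truncn (green v)).+1) := sum_rw_nstep_le_green v.
apply/negP; rewrite -ltNge.
apply: (@lt_le_trans _ _ ((Num.truncn (green v)).+1%:R)%:E).
  by rewrite lte_fin truncnS_gt.
apply: (@le_trans _ _ (\sum_(0 <= k < (Num.truncn (green v)).+1) 1)%E).
  by rewrite sumEFin lee_fin sumr_const_nat subn0.
by apply: lee_sum => k _.
Qed.

Variable B : seq V.
Hypothesis uB : uniq B.

Definition killed_step f y : R := \sum_(z <- B) c y z / pi y * f z.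
Local Notation P := killed_step.
Let ip f g : R := \sum_(y <- B) pi y * f y * g y.

(** The form (f, (I - P_B) f) of l^2(pi), where P_B is [killed_step], the transition operator of the
    walk killed on leaving B. *)
Definition killed_form f : R :=
  \sum_(y <- B) pi y * f y ^+ 2 - \sum_(y <- B) \sum_(z <- B) c y z * f y * f z.

Let ipP f g : ip f (P g) = \sum_(y <- B) \sum_(z <- B) c y z * f y * g z.
Proof.
apply: eq_bigr => y _; rewrite mulr_sumr; apply: eq_bigr => z _.
have := vertex_weight_gt0 y; move=> p0; field; lra.
Qed.

Let ipPC f g : ip f (P g) = ip (P f) g.
Proof.
have -> : ip (P f) g = ip g (P f) by apply: eq_bigr => y _; ring.
rewrite !ipP exchange_big; apply: eq_bigr => y _; apply: eq_bigr => z _.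
by rewrite cs; ring.
Qed.

Let killed_formE f : killed_form f = ip f f - ip f (P f).
Proof. by rewrite ipP; congr (_ - _); apply: eq_bigr => y _; rewrite expr2 mulrA. Qed.

Lemma killed_form_ge0 f : 0 <= killed_form f.
Proof.
rewrite subr_ge0.
have h y : y \in B -> \sum_(z <- B) c y z * f y ^+ 2 <= pi y * f y ^+ 2.
  by move=> yB; rewrite -mulr_suml ler_wpM2r ?sqr_ge0 // sum_le_vertex_weight.
have h1 : \sum_(y <- B) \sum_(z <- B) c y z * f y ^+ 2 <= \sum_(y <- B) pi y * f y ^+ 2.
  by rewrite big_seq [leRHS]big_seq; apply: ler_sum.
have h2 : \sum_(y <- B) \sum_(z <- B) c y z * f z ^+ 2 =
   \sum_(y <- B) \sum_(z <- B) c y z * f y ^+ 2.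
  by rewrite exchange_big; apply: eq_bigr => y _; apply: eq_bigr => z _; rewrite cs.
suff : 2 * (\sum_(y <- B) \sum_(z <- B) c y z * f y * f z) <=
  \sum_(y <- B) \sum_(z <- B) c y z * f y ^+ 2 +
  \sum_(y <- B) \sum_(z <- B) c y z * f z ^+ 2 by lra.
rewrite mulr_sumr -big_split; apply: ler_sum => y _ /=.
rewrite mulr_sumr -big_split; apply: ler_sum => z _ /=.
have := sqr_ge0 (f y - f z); have := c0 y z; nra.
Qed.

Variables (v : V) (vB : v \in B).
Let d (y : V) : R := (y == v)%:R.
Let p n := iter n P d.

Let p_ge0 n y : 0 <= p n y.
Proof.
elim: n y => [|n IH] y; first exact: ler0n.
rewrite /p iterS; apply: sumr_ge0 => z _; apply: mulr_ge0; last exact: IH.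
by rewrite divr_ge0 // ltW // vertex_weight_gt0.
Qed.

(** Killing only removes trajectories. This is how the transience of the whole network reaches P_B,
    with a bound that does not depend on B. *)
Let p_le n y : ((p n y)%:E <= rw_nstep c n y v)%E.
Proof.
elim: n y => [|n IH] y //=.
apply: le_trans (sum_le_esum _ uB).
rewrite /P -sumEFin; apply: lee_sum => z _.
rewrite EFinM /rw_step vertex_weightE eqe gt_eqF ?vertex_weight_gt0 //.
apply: lee_wpmul2l => //; rewrite lee_fin divr_ge0 // ltW //.
exact: vertex_weight_gt0.
Qed.

Let sum_p_le n : \sum_(0 <= k < n) p k v <= green v.
Proof.
rewrite -lee_fin -sumEFin; apply: le_trans (sum_rw_nstep_le_green v n).
by apply: lee_sum => k _; exact: p_le.
Qed.

Let green_ge1 : 1 <= green v.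
Proof. by have := sum_p_le 1; rewrite big_nat1 /p /= /d eqxx. Qed.

(** Even times are the useful ones: by [ip_p], pi(v) p_{2n}(v) is the squared norm of p_n, so the
    remainder P_B^n d_v of the truncated Green function can be made small in l^2(pi). *)
Let p_small e : 0 < e -> exists n, p n.*2 v <= e.
Proof.
move=> e0; apply: contrapT => /forallNP h.
set N := (Num.truncn (green v / e)).+1.
have := sum_p_le (N.*2); apply/negP; rewrite -ltNge.
have : green v / e < N%:R by rewrite truncnS_gt.
rewrite ltr_pdivrMr // => /lt_le_trans; apply.
have -> : N%:R * e = \sum_(0 <= k < N) e by rewrite sumr_const_nat subn0 mulr_natl.
have -> : \sum_(0 <= k < N.*2) p k v = \sum_(0 <= k < N) (p k.*2 v + p k.*2.+1 v).
  elim: N => [|m IH]; first by rewrite !big_nil.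
  by rewrite doubleS !big_nat_recr //= IH addrA.
apply: ler_sum => k _; have /negP := h k; rewrite -ltNge => /ltW; have := p_ge0 k.*2.+1 v; lra.
Qed.

Let ip_d f : ip f d = pi v * f v.
Proof.
rewrite /ip (bigD1_seq v) //= /d eqxx mulr1 big1 ?addr0 // => y /negbTE ->.
by rewrite mulr0.
Qed.

Let ip_p n : ip (p n) (p n) = pi v * p n.*2 v.
Proof.
suff h j i : ip (p i) (p j) = ip (p (i + j)) d by rewrite h ip_d addnn.
elim: j i => [|j IH] i; first by rewrite addn0.
by rewrite [p j.+1]/(P (p j)) ipPC -[P (p i)]/(p i.+1) IH addSnnS.
Qed.

Let g n y : R := \sum_(0 <= k < n) p k y.

Let Pg n y : P (g n) y = g n y - d y + p n y.
Proof.
elim: n => [|n IH].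
  rewrite /P big1; first by rewrite /g big_nil; rewrite /p /=; lra.
  by move=> z _; rewrite /g big_nil mulr0.
have gS z : g n.+1 z = g n z + p n z by rewrite /g big_nat_recr.
have -> : P (g n.+1) y = P (g n) y + P (p n) y.
  by rewrite /P -big_split; apply: eq_bigr => z _ /=; rewrite gS mulrDr.
by rewrite IH gS -[P (p n)]/(p n.+1); lra.
Qed.

(* The quadratic form of I - P_B is nonnegative at f - s g_n, where
   g_n = sum_(k < n) P_B^k d_v satisfies (I - P_B) g_n = d_v - P_B^n d_v. *)
Let killed_form_g n f s :
  0 <= killed_form f - 2 * s * (pi v * f v - ip f (p n)) + s ^+ 2 * (pi v * green v).
Proof.
have h := killed_form_ge0 (fun y => f y - s * g n y).
have lin a b : ip (fun y => a y - s * g n y) b = ip a b - s * ip (g n) b.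
  by rewrite /ip mulr_sumr -sumrB; apply: eq_bigr => y _; ring.
have linr a b : ip b (fun y => a y - s * g n y) = ip b a - s * ip b (g n).
  by rewrite /ip mulr_sumr -sumrB; apply: eq_bigr => y _; ring.
have Plin a : P (fun y => a y - s * g n y) = (fun y => P a y - s * P (g n) y).
  by apply/funext => y; rewrite /P mulr_sumr -sumrB; apply: eq_bigr => z _; ring.
have ipPg a : ip a (P (g n)) = ip a (g n) - pi v * a v + ip a (p n).
  rewrite -ip_d /ip -sumrB -big_split; apply: eq_bigr => y _ /=; rewrite Pg; ring.
have linrP a b : ip b (fun y => P a y - s * P (g n) y) = ip b (P a) - s * ip b (P (g n)).
  by rewrite /ip mulr_sumr -sumrB; apply: eq_bigr => y _; ring.
have ipC a b : ip a b = ip b a by apply: eq_bigr => y _; ring.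
have gle : g n v <= green v by exact: sum_p_le.
have gp0 : 0 <= ip (g n) (p n).
  apply: sumr_ge0 => y _; apply: mulr_ge0; last exact: p_ge0.
  apply: mulr_ge0; first exact/ltW/vertex_weight_gt0.
  by apply: sumr_ge0 => k _; exact: p_ge0.
move: h; rewrite killed_formE Plin !linrP !lin !linr.
rewrite (ipC (g n) (P f)) -(ipPC f (g n)) !ipPg -(ipC f (g n)) killed_formE => h.
apply: (le_trans h).
have pv := vertex_weight_gt0 v.
have : s ^+ 2 * (pi v * g n v) <= s ^+ 2 * (pi v * green v).
  by rewrite ler_wpM2l ?sqr_ge0 // ler_wpM2l // ltW.
have : 0 <= s ^+ 2 * ip (g n) (p n) by rewrite mulr_ge0 // sqr_ge0.
rewrite expr2; lra.
Qed.

(** Cauchy-Schwarz for the killed form between f and the Green function of B with pole v, whose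
    energy is at most pi(v) [green v]. The partial sums g_n replace the Green function up to an
    arbitrary error e, which avoids inverting I - P_B. *)
Lemma killed_form_ge f : pi v * f v ^+ 2 <= green v * killed_form f.
Proof.
have pv := vertex_weight_gt0 v.
have G1 := green_ge1.
suff h s : 0 <= killed_form f - 2 * s * (pi v * f v) + s ^+ 2 * (pi v * green v).
  (* This value of s minimises the quadratic polynomial in [h]. *)
  have := h (f v / green v).
  have -> : killed_form f - 2 * (f v / green v) * (pi v * f v) +
    (f v / green v) ^+ 2 * (pi v * green v) = killed_form f - pi v * f v ^+ 2 / green v.
    by field; lra.
  rewrite subr_ge0 ler_pdivrMr; [lra|exact: lt_le_trans G1].
apply/ler_addgt0Pr => e e0.
set S := ip f f + pi v.
have S0 : 0 < S.
  rewrite ltr_wpDl //; apply: sumr_ge0 => y _; rewrite -mulrA mulr_ge0 //.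
    exact/ltW/vertex_weight_gt0.
  by rewrite -expr2 sqr_ge0.
(* By weighted AM-GM, 2 |(f, p_n)| <= t (f, f) + pi(v) p_{2n}(v) / t, which is at most t S once
   p_{2n}(v) <= t^2. The choice of t gives |s| t S <= e, and the [+ 1] covers s = 0. *)
pose t : R := e / (S * (`|s| + 1)).
have t0 : 0 < t by rewrite divr_gt0 // mulr_gt0 // ltr_wpDl.
have [n pn] := p_small (exprn_gt0 2 t0).
have := killed_form_g n f s.
suff : 2 * s * ip f (p n) <= e by lra.
apply: (@le_trans _ _ (`|s| * (t * S))); last first.
  have s1 : 0 < `|s| + 1 by rewrite ltr_wpDl.
  have -> : `|s| * (t * S) = e * (`|s| / (`|s| + 1)).
    have -> : t * S = e / (`|s| + 1).
      by rewrite /t invfM mulrA mulrAC divfK // gt_eqF.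
    by rewrite mulrCA.
  rewrite ler_piMr ?(ltW e0) // ler_pdivrMr ?mul1r ?lerDl //.
have amgm : `|2 * ip f (p n)| <= t * ip f f + t^-1 * ip (p n) (p n).
  rewrite /ip !mulr_sumr -big_split /=; apply: (le_trans (ler_norm_sum _ _ _)).
  apply: ler_sum => y _; have py := vertex_weight_gt0 y.
  have -> : t * (pi y * f y * f y) + t^-1 * (pi y * p n y * p n y) =
   pi y * t^-1 * ((t * f y) ^+ 2 + p n y ^+ 2) by field; lra.
  have -> : 2 * (pi y * f y * p n y) = pi y * t^-1 * (2 * (t * f y * p n y)).
    by field; lra.
  have pt : 0 <= pi y * t^-1 by rewrite mulr_ge0 // ?invr_ge0 ltW.
  rewrite normrM (ger0_norm pt) ler_wpM2l //.
  rewrite ler_norml; apply/andP; split.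
    have := sqr_ge0 (t * f y + p n y); nra.
  have := sqr_ge0 (t * f y - p n y); nra.
apply: (@le_trans _ _ (`|s| * `|2 * ip f (p n)|)).
  by rewrite (mulrC 2) -mulrA -normrM ler_norm.
rewrite ler_wpM2l //; apply: (le_trans amgm).
rewrite ip_p /S mulrDr lerD2l.
rewrite ler_pdivrMl //; have := ler_wpM2l (ltW pv) pn; nra.
Qed.

End transient.
End total_conductance.

(** * Reduction to a finite network *)

Section truncated_dirichlet.
Context {R : realType} {V : countType}.
Variable c : V -> V -> R.
Hypothesis c_cond : conductances c.
Hypothesis c_trans : rw_transient c.
Local Notation pi := (vertex_weight c).

(** [green c y / pi y] is the effective resistance from y to infinity; the factor 2 pays for
    truncating the network. *)
Definition resistance y : R := 2 * green c y / pi y.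

Lemma green_gt0 y : 0 < green c y.
Proof.
have := sum_rw_nstep_le_green c_cond c_trans y 1.
by rewrite big_nat1 /= eqxx lee_fin; apply: lt_le_trans.
Qed.

Lemma resistance_gt0 y : 0 < resistance y.
Proof. by rewrite divr_gt0 ?mulr_gt0 ?green_gt0 ?vertex_weight_gt0. Qed.

(** The subtracted sum is the killing through edges that leave [B ++ B'], which the finite Dirichlet
    form does not see. *)
Lemma dirichlet_killed (B B' : seq V) f : (forall z, z \notin B -> f z = 0) ->
  uniq (B ++ B') ->
  dirichlet (B ++ B') c f f = killed_form c B f -
    \sum_(y <- B) (pi y - \sum_(z <- B ++ B') c y z) * f y ^+ 2.
Proof.
move=> f0 uBB'.
have B'0 (a : V -> R) z : z \in B' -> f z * a z = 0.
  move=> zB'; rewrite f0 ?mul0r //; move: uBB'; rewrite cat_uniq => /and3P[_ + _].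
  by apply: contra => zB; apply/hasP; exists z.
have redB (a : V -> R) : \sum_(z <- B ++ B') f z * a z = \sum_(z <- B) f z * a z.
  rewrite big_cat /= [X in _ + X]big_seq [X in _ + X]big1 ?addr0 // => z.
  exact: B'0.
rewrite -dirichlet_laplacian; last by case: c_cond.
have -> : \sum_(z <- B ++ B') laplacian (B ++ B') c f z * f z =
   \sum_(z <- B) f z * laplacian (B ++ B') c f z.
  by rewrite -redB; apply: eq_bigr => z _; rewrite mulrC.
rewrite /killed_form -addrA -opprD addrC -[RHS]addrC.
have lapE z : laplacian (B ++ B') c f z =
    (\sum_(y <- B ++ B') c z y) * f z - \sum_(y <- B) f y * c z y.
  rewrite -redB mulr_suml -sumrB; apply: eq_bigr => y _; ring.
rewrite opprD addrCA -sumrN -sumrN -!big_split /=.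
apply: eq_bigr => z _; rewrite lapE mulrBr.
have -> : \sum_(i <- B) c z i * f z * f i = f z * \sum_(y <- B) f y * c z y.
  by rewrite mulr_sumr; apply: eq_bigr => i _; ring.
ring.
Qed.

Lemma exists_finite_dirichlet (B : seq V) : uniq B ->
  exists2 B', uniq (B ++ B') & forall f, (forall z, z \notin B -> f z = 0) ->
    forall y, y \in B -> f y ^+ 2 <= resistance y * dirichlet (B ++ B') c f f.
Proof.
move=> uB.
pose D := \sum_(y <- B) green c y / pi y.
have D0 : 0 <= D.
  by apply: sumr_ge0 => y _; rewrite divr_ge0 // ltW // ?green_gt0 ?vertex_weight_gt0.
(* By [kf] below, the invisible killing is at most e D times the killed form, hence at most half of
   it. The [+ 1] keeps e positive even for empty B. *)
pose e := (2 * (D + 1))^-1.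
have e0 : 0 < e by rewrite invr_gt0; lra.
have [B' uBB' tail] := exists_finite_vertex_weight c_cond e0 uB.
exists B' => // f f0 y yB.
have kf y' : y' \in B -> f y' ^+ 2 <= green c y' / pi y' * killed_form c B f.
  move=> y'B; have := killed_form_ge c_cond c_trans uB y'B f.
  by rewrite mulrAC ler_pdivlMr ?vertex_weight_gt0 // mulrC.
have : \sum_(y <- B) (pi y - \sum_(z <- B ++ B') c y z) * f y ^+ 2 <=
    e * (D * killed_form c B f).
  rewrite /D mulr_suml mulr_sumr big_seq [leRHS]big_seq.
  apply: ler_sum => z zB; apply: ler_pM.
  - by rewrite subr_ge0 (sum_le_vertex_weight c_cond).
  - exact: sqr_ge0.
  - by have := tail z zB; lra.
  - exact: kf.
have eD : e * D <= 1 / 2.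
  by rewrite /e mulrC ler_pdivrMr; lra.
have kf0 := killed_form_ge0 c_cond uB f.
have : e * D * killed_form c B f <= 1 / 2 * killed_form c B f by rewrite ler_wpM2r.
rewrite dirichlet_killed // mulrA => h1 h2.
apply: (le_trans (kf y yB)).
have a0 : 0 <= green c y / pi y.
  by rewrite divr_ge0 // ltW // ?green_gt0 ?vertex_weight_gt0.
have -> b : resistance y * b = green c y / pi y * (2 * b) by rewrite /resistance; ring.
by rewrite ler_wpM2l //; lra.
Qed.

End truncated_dirichlet.

(** * Bound on the discrete occupation of v *)

Section energy_bound.
Context {R : realType} {V : countType}.

(** In [energy_sum] the energy of F has a negative sign and absorbs F(x) and F(v), which are
    controlled by that same energy. The error term comes from F <= n at every vertex, summed over n
    steps. *)
Lemma energy_bound (B B' : seq V) (c : V -> V -> R) (Cx Cv h rho : R) (x v : V)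
   (m : nat -> V -> V -> R) (u : nat -> V -> R) n :
  uniq (B ++ B') -> x \in B ->
  0 < Cx -> 0 < Cv -> 0 < h -> 0 <= rho ->
  (forall f, (forall z, z \notin B -> f z = 0) ->
     f x ^+ 2 <= Cx * dirichlet (B ++ B') c f f /\
     f v ^+ 2 <= Cv * dirichlet (B ++ B') c f f) ->
  (forall k y z, m k y z = m k z y) -> (forall k y z, 0 <= m k y z) ->
  (forall k z, z \in B ++ B' -> \sum_(y <- B ++ B') m k z y <= 1) ->
  (forall k y z, m k y z <= m k.+1 y z) ->
  (forall y z, h * c y z <= m 0%N y z) ->
  (forall k z, 0 <= u k z <= 1) ->
  (forall k z, z \notin B -> u k z = 0) ->
  (forall z, u 0%N z = (z == x)%:R) ->
  (forall k z, z \in B -> u k.+1 z <= u k z - laplacian (B ++ B') (m k) (u k) z + rho) ->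
  h * \sum_(j < n) u j v <= Cx + Cv + h * rho * (n ^ 2 * size (B ++ B'))%:R.
Proof.
move=> uBB' xB Cx0 Cv0 h0 rho0 dir ms m0 m1 mn mc u01 uB u0 step.
have u_ge0 k z : 0 <= u k z by case/andP: (u01 k z).
have := @energy_sum R V (B ++ B') m u v rho n ms m0 m1 mn u_ge0 rho0.
move=> /(_ _)/wrap[|/=].
  move=> k z zW [j uj]; apply: step; apply: contraT => /(uB j) uj0.
  by rewrite uj0 eqxx in uj.
set F := fun z : V => \sum_(j < n) u j z => en.
have FB z : z \notin B -> F z = 0 by move=> zB; apply: big1 => j _; exact: uB.
have [Fx Fv] := dir F FB.
have xW : x \in B ++ B' by rewrite mem_cat xB.
have ux : \sum_(z <- B ++ B') u 0%N z * F z = F x.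
  rewrite (bigD1_seq x) //= u0 eqxx mul1r big1 ?addr0 // => z /negbTE zx.
  by rewrite u0 zx mul0r.
have Fn z : F z <= n%:R.
  rewrite /F -[n in leRHS]card_ord -sum1_card natr_sum; apply: ler_sum => j _.
  by case/andP: (u01 j z).
have FW : \sum_(z <- B ++ B') F z <= n%:R * (size (B ++ B'))%:R.
  have -> : n%:R * (size (B ++ B'))%:R = \sum_(z <- B ++ B') n%:R :> R.
    by rewrite big_const_seq count_predT iter_addr_0 mulr_natr.
  by apply: ler_sum => z _; exact: Fn.
have mE := le_dirichlet (B ++ B') F mc.
rewrite dirichletZ in mE.
rewrite ux in en.
set E := dirichlet (B ++ B') c F F in Fx Fv mE.
(* Young's inequality, spending half of the available energy: the instances at x and at v together
   use up the negative energy term of [en] multiplied by h. *)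
have half C a : 0 < C -> a ^+ 2 <= C * E -> h * (2 * a) <= 2 * C + h * (h * E) / 2.
  move=> C0 aC; rewrite -(ler_pM2l C0).
  have := sqr_ge0 (h * a - 2 * C).
  have : h ^+ 2 * a ^+ 2 <= h ^+ 2 * (C * E) by rewrite ler_wpM2l // sqr_ge0.
  lra.
have hx := half _ _ Cx0 Fx.
have hv := half _ _ Cv0 Fv.
have : h * (2 * (\sum_(j < n) u j v)) <=
   h * (2 * F x + 2 * F v - h * E + 2 * rho * n%:R * (n%:R * (size (B ++ B'))%:R)).
  rewrite ler_wpM2l ?(ltW h0) //; apply: (le_trans en).
  apply: lerD; first by rewrite -/(F v); lra.
  by rewrite ler_wpM2l // !mulr_ge0.
rewrite natrM natrX -/(F v); rewrite -/(F v) => H; lra.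
Qed.

End energy_bound.

(** * Poisson clocks on a grid *)

(** The trace of P on F and the multiple of P by P(F) are finite measures of equal total mass that
    agree on the pi-system G. *)
Lemma indep_g_sigma_algebra d (T : measurableType d) (R : realType)
    (P : probability T R) (G : set (set T)) (F : set T) :
  G `<=` measurable -> setI_closed G -> measurable F ->
  (forall A, G A -> P (A `&` F) = (P A * P F)%E) ->
  forall A, <<s G >> A -> P (A `&` F) = (P A * P F)%E.
Proof.
move=> Gm GI mF GF A GA.
have PF0 : 0 <= fine (P F) by exact: fine_ge0.
have PFE : P F = (fine (P F))%:E by rewrite fineK // fin_num_measure.
have GE : [set X | G X /\ X `<=` setT] = G.
  by apply/seteqP; split => X /=; [case|split].
have := @g_sigma_algebra_measure_unique_trace _ R T G setT measurableT.
rewrite GE => /(_ Gm GI (mrestr P mF) (mscale (NngNum PF0) P)).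
move=> /(_ _ _ _ _ A GA) h; rewrite muleC PFE; apply: h => //=.
- by rewrite /mrestr /mscale /= setTI probability_setT mule1.
- by move=> B GB; rewrite /mrestr /mscale /= GF // muleC PFE.
- by rewrite /mrestr setTI -ge0_fin_numE // fin_num_measure.
Qed.

Section grid.
Context {R : realType} {V : countType} (c : R -> V -> V -> R).
Hypothesis c_cond : forall t, 0 <= t -> conductances (c t).
Hypothesis c_ndecr : forall s t u v, 0 <= s -> s <= t -> c s u v <= c t u v.
Variable h : R.
Hypothesis h0 : 0 < h.

Definition grid k : R := k%:R * h.

Lemma grid_ge0 k : 0 <= grid k.
Proof. by rewrite mulr_ge0 // ltW. Qed.

Lemma grid_homo : {homo grid : m n / (m <= n)%N >-> m <= n}.
Proof. by move=> m n mn; rewrite ler_pM2r // ler_nat. Qed.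

Lemma gridS k : grid k.+1 = grid k + h.
Proof. by rewrite /grid -natr1 mulrDl mul1r. Qed.

(** Closed on the right: a jump at time [grid k] lies in the previous cell, and the walk observed at
    [grid k] has already made it. *)
Definition cell k : set R := `]grid k, grid k.+1].

Definition mass k y z : R := \int[lebesgue_measure]_(t in cell k) c t y z.

Let cell_ge0 k s : cell k s -> 0 <= s.
Proof. by rewrite /cell /= in_itv /= => /andP[/ltW + _]; apply: le_trans; exact: grid_ge0. Qed.

Let leb_cell k : lebesgue_measure (cell k) = h%:E.
Proof.
rewrite lebesgue_measure_itv /= lte_fin gridS ltrDl h0 -EFinB; congr EFin; lra.
Qed.

Let integrable_c k y z : lebesgue_measure.-integrable (cell k) (EFin \o (fun t => c t y z)).
Proof.
have mD : measurable (cell k) by exact: measurable_itv.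
apply: measurable_bounded_integrable => //.
- by rewrite [ltLHS]leb_cell ltry.
(* Monotonicity is known for nonnegative times only; the maximum with 0 makes the function monotone,
   hence measurable, on the whole line. *)
- apply: (eq_measurable_fun (fun t : R => c (Num.max t 0) y z)).
    by move=> t; rewrite inE => /cell_ge0 t0; rewrite max_l.
  apply: nondecreasing_measurable => // s t st; apply: c_ndecr.
    by rewrite le_max lexx orbT.
  by rewrite ge_max le_max st /= le_max lexx orbT.
- exists (c (grid k.+1) y z); split; first exact: num_real.
  move=> M cM t /= tk; have t0 := cell_ge0 tk.
  have [c0 _ _ _] := c_cond t0.
  rewrite ger0_norm // (le_trans _ (ltW cM)) // c_ndecr //.
  by move: tk; rewrite /cell /= in_itv /= => /andP[].
Qed.

Let Rintegral_cell k r : \int[lebesgue_measure]_(t in cell k) (cst r t) = h * r.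
Proof.
rewrite Rintegral_cst; last exact: measurable_itv.
by rewrite [X in fine X]leb_cell mulrC.
Qed.

Let integrable_cst k r : lebesgue_measure.-integrable (cell k) (EFin \o (@cst R R r)).
Proof.
apply: measurable_bounded_integrable; first exact: measurable_itv.
- by rewrite [ltLHS]leb_cell ltry.
- exact: measurable_cst.
- by exists `|r|; split; [exact: num_real|move=> M rM t _ /=; exact: ltW].
Qed.

Lemma mass_ge k y z : h * c (grid k) y z <= mass k y z.
Proof.
rewrite -(Rintegral_cell k); apply: le_Rintegral => //; first exact: measurable_itv.
move=> t; rewrite /cell /= in_itv /= => /andP[/ltW kt _].
exact/c_ndecr/kt/grid_ge0.
Qed.

Lemma mass_le k y z : mass k y z <= h * c (grid k.+1) y z.
Proof.
rewrite -(Rintegral_cell k); apply: le_Rintegral => //; first exact: measurable_itv.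
move=> t tk; apply: c_ndecr; first exact: cell_ge0 tk.
by move: tk; rewrite /cell /= in_itv /= => /andP[].
Qed.

Lemma mass_homo k y z : mass k y z <= mass k.+1 y z.
Proof. exact: le_trans (mass_le _ _ _) (mass_ge _ _ _). Qed.

Lemma mass_ge0 k y z : 0 <= mass k y z.
Proof.
apply: le_trans (mass_ge k y z); apply: mulr_ge0; first exact: ltW.
by case: (c_cond (grid_ge0 k)).
Qed.

Lemma mass_sym k y z : mass k y z = mass k z y.
Proof.
apply: eq_Rintegral => t; rewrite inE => /cell_ge0 /c_cond [_ cs _ _].
exact: cs.
Qed.

Context d (Omega : measurableType d) (P : probability Omega R).
Variable clock : V -> V -> Omega -> set R.
Hypothesis clocks : edge_clocks P c clock.

Definition quiet k y z : set Omega :=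
  [set w | clock y z w `&` cell k = set0].

Definition quiet_prob k y z : R := expR (- mass k y z).

Lemma counting_nat (S : set R) n :
  counting S = n%:R%:E :> \bar R -> finite_set S /\ #|` fset_set S| = n.
Proof.
rewrite /counting; case: ifPn => // /asboolP finS [/eqP].
by rewrite eqr_nat => /eqP.
Qed.

Lemma counting0P (S : set R) : (counting S = 0%:R%:E :> \bar R) <-> S = set0.
Proof.
split=> [/(counting_nat (n := 0)) [finS /cardfs0_eq S0]|->].
  by rewrite -(fset_setK finS) S0 set_fset0.
by rewrite /counting fset_set0 cardfs0 asboolT //; exact: finite_set0.
Qed.

Lemma counting1_uniq (S : set R) s t :
  counting S = 1%:R%:E :> \bar R -> S s -> S t -> s = t.
Proof.
move=> /(counting_nat (n := 1)) [finS /eqP /cardfs1P [a Sa]].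
have memS u : S u -> u = a.
  by move=> Su; apply/eqP; rewrite -in_fset1 -Sa in_fset_set // inE.
by move=> /memS -> /memS ->.
Qed.

Let num_rings k y z : Omega -> \bar R := nb_rings (clock y z) (grid k) (grid k.+1).

(** Expressed by the counts 0 and 1, whose probabilities are explicit; an infinite count is
    included. *)
Definition multiple k y z : set Omega :=
  ~` ([set w | num_rings k y z w = 0%:R%:E] `|` [set w | num_rings k y z w = 1%:R%:E]).

Lemma quietE k y z : quiet k y z = [set w | num_rings k y z w = 0%:R%:E].
Proof. by apply/seteqP; split => w /=; rewrite /num_rings /nb_rings => /counting0P. Qed.

Lemma quietC k y z : quiet k y z = quiet k z y.
Proof. by case: clocks => cs _ _; rewrite /quiet cs. Qed.

Lemma two_rings_multiple k y z w s t : clock y z w s -> clock y z w t ->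
  cell k s -> cell k t -> s != t -> multiple k y z w.
Proof.
move=> ys yt ks kt /eqP st [] /=; rewrite /num_rings /nb_rings.
  by move/counting0P => /seteqP [+ _] => /(_ s); apply.
by move=> /counting1_uniq /(_ (conj ys ks) (conj yt kt)).
Qed.

Section one_clock.
Variables (y z : V) (yz : y != z).

Let poisson : poisson_clock P (fun t => c t y z) (clock y z).
Proof. by case: clocks => _ + _; exact. Qed.

Let grid_le k : 0 <= grid k <= grid k.+1.
Proof. by rewrite grid_ge0 grid_homo. Qed.

Let measurable_num_rings k n : measurable [set w | num_rings k y z w = n%:R%:E].
Proof.
have [mN _ _] := poisson.
have := mN _ _ (grid_le k) measurableT _ (emeasurable_set1 n%:R%:E).
by rewrite setTI.
Qed.

Lemma measurable_quiet k : measurable (quiet k y z).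
Proof. by rewrite quietE. Qed.

Lemma measurable_multiple k : measurable (multiple k y z).
Proof. by apply/measurableC/measurableU. Qed.

Let prob_num_rings k n :
  P [set w | num_rings k y z w = n%:R%:E] = (poisson_mass (mass k y z) n)%:E.
Proof. by have [_ + _] := poisson; apply; exact: grid_le. Qed.

Lemma prob_quiet k : P (quiet k y z) = (quiet_prob k y z)%:E.
Proof.
by rewrite quietE prob_num_rings /poisson_mass expr0 fact0 divr1 mul1r.
Qed.

Lemma prob_multiple k : (P (multiple k y z) <= (mass k y z ^+ 2)%:E)%E.
Proof.
have PU : P ([set w | num_rings k y z w = 0%:R%:E] `|` [set w | num_rings k y z w = 1%:R%:E])
    = (poisson_mass (mass k y z) 0 + poisson_mass (mass k y z) 1)%:E.
  rewrite EFinD -!prob_num_rings; apply: measureU => //.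
  by apply/seteqP; split => // w [/= -> [/eqP]]; rewrite eqr_nat.
rewrite probability_setC; last exact: measurableU.
rewrite [X in (1 - X)%E]PU -EFinB lee_fin /poisson_mass.
rewrite expr0 expr1 fact0 factS fact0 !divr1 mul1r.
(* With m the mass, 1 - (1 + m) exp (- m) <= m^2 follows from exp (- m) >= 1 - m. *)
have := expR_ge1Dx (- mass k y z); have := mass_ge0 k y z.
nra.
Qed.

Lemma quiet_sigma_rings k :
  sigma_rings (clock y z) (grid k) (grid k.+1) (quiet k y z).
Proof.
by rewrite quietE; exists [set 0%:R%:E] => //; rewrite setTI.
Qed.

Lemma prob_quiet_times (a : nat -> bool) n :
  P (\bigcap_(k < n) if a k then quiet k y z else setT) =
  (\prod_(k < n) if a k then quiet_prob k y z else 1)%:E.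
Proof.
have [_ _ indep] := poisson.
have [_ /(_ [fset k in iota 0 n]%fset)] := indep grid (grid_ge0 0) grid_homo.
move=> /(_ (fun k => if a k then quiet k y z else setT)).
have -> : [set` [fset k in iota 0 n]%fset] = `I_n.
  by apply/seteqP; split => k /=; rewrite !inE /= mem_iota add0n.
move=> -> //; last first.
  move=> k _; case: (a k); first exact: quiet_sigma_rings.
  by exists setT => //; rewrite preimage_setT setTI.
rewrite -prodEFin -(big_mkord xpredT (fun k => (if a k then quiet_prob k y z else 1)%:E)).
rewrite /index_iota subn0.
rewrite (perm_big (iota 0 n)) /=; last first.
  by apply: uniq_perm; rewrite ?fset_uniq ?iota_uniq // => k; rewrite !inE.
apply: eq_bigr => k _; case: (a k); first exact: prob_quiet.
exact: probability_setT.
Qed.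

End one_clock.

End grid.

(** * Unoriented edges of a finite vertex set *)

Section edges.
Context {V : countType}.
Implicit Types (y z : V) (e : V * V) (W : seq V).

Definition oriented e : bool := (choice.pickle e.1 < choice.pickle e.2)%N.

Definition edge y z : V * V := if oriented (y, z) then (y, z) else (z, y).

Lemma oriented_edge y z : y != z -> oriented (edge y z).
Proof.
rewrite /edge => yz; case: ifPn => //; rewrite /oriented /= -leqNgt leq_eqVlt.
case/orP => // /eqP p; case/eqP: yz; apply/esym.
exact: (pcan_inj choice.pickleK).
Qed.

Lemma edgeC y z : edge y z = edge z y.
Proof.
rewrite /edge /oriented /=; case: ltngtP => // p.
by have -> : y = z by exact: (pcan_inj choice.pickleK).
Qed.

Lemma edge_oriented e : oriented e -> edge e.1 e.2 = e.
Proof. by case: e => y z; rewrite /edge => /= ->. Qed.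

Lemma edge_inj z : injective (edge z).
Proof.
move=> y y'; rewrite /edge; case: ifP => o; case: ifP => o' [] //.
- by move=> -> ->.
- by move=> -> ->.
Qed.

Definition edges W : {fset V * V} :=
  [fset e in [seq (y, z) | y <- W, z <- W] | oriented e]%fset.

Lemma mem_edges W e : (e \in edges W) = [&& oriented e, e.1 \in W & e.2 \in W].
Proof.
rewrite !inE /= andbC; congr (_ && _); case: e => y z /=.
apply/allpairsP/andP => [[[a b] /= [aW bW [-> ->]]]//|[yW zW]].
by exists (y, z).
Qed.

Lemma edge_edges W y z : y \in W -> z \in W -> y != z -> edge y z \in edges W.
Proof.
move=> yW zW yz; rewrite mem_edges oriented_edge //= /edge.
by case: ifP => _ /=; rewrite yW zW.
Qed.

Definition incident z e : bool := (e.1 == z) || (e.2 == z).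

Lemma incident_edge z y : incident z (edge z y).
Proof. by rewrite /incident /edge; case: ifP; rewrite /= eqxx ?orbT. Qed.

(** Converts a product over the edges at z into one over the other vertices of W, as needed for
    [prob_still]. *)
Lemma perm_incident W z : uniq W -> z \in W ->
  perm_eq [seq e <- edges W | incident z e] [seq edge z y | y <- W & y != z].
Proof.
move=> uW zW; apply: uniq_perm.
- by rewrite filter_uniq // fset_uniq.
- by rewrite map_inj_uniq ?filter_uniq //; exact: edge_inj.
move=> e; rewrite mem_filter; apply/andP/mapP => [[ze]|[y]].
  rewrite mem_edges => /and3P[oe e1 e2].
  case/orP: ze => /eqP ez; rewrite -ez in zW *.
    exists e.2; last by rewrite edge_oriented.
    rewrite mem_filter e2 andbT; apply/eqP => e21.
    by move: oe; rewrite /oriented e21 ltnn.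
  exists e.1; last by rewrite edgeC edge_oriented.
  rewrite mem_filter e1 andbT; apply/eqP => e21.
  by move: oe; rewrite /oriented e21 ltnn.
rewrite mem_filter => /andP[yz yW] ->; split; first exact: incident_edge.
by rewrite edge_edges // eq_sym.
Qed.

End edges.

Lemma fset_bigcap_measurable d (T : measurableType d) (I : choiceType)
    (J : {fset I}) (F : I -> set T) :
  (forall i, i \in J -> measurable (F i)) ->
  measurable (\bigcap_(i in [set` J]) F i).
Proof.
move=> JF; rewrite -[X in measurable X]setCK setC_bigcap; apply: measurableC.
by apply: fin_bigcup_measurable => // i /= iJ; exact/measurableC/JF.
Qed.

(** * Independence of the cells of the grid *)

Section grid_events.
Context {R : realType} {V : countType} (c : R -> V -> V -> R).
Hypothesis c_cond : forall t, 0 <= t -> conductances (c t).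
Hypothesis c_ndecr : forall s t u v, 0 <= s -> s <= t -> c s u v <= c t u v.
Variable h : R.
Hypothesis h0 : 0 < h.
Context d (Omega : measurableType d) (P : probability Omega R).
Variable clock : V -> V -> Omega -> set R.
Hypothesis clocks : edge_clocks P c clock.
Variable W : seq V.
Hypothesis uW : uniq W.

Local Notation quiet := (quiet h clock).
Local Notation mass := (mass c h).
Local Notation quiet_prob := (quiet_prob c h).

Lemma oriented_neq (e : V * V) : oriented e -> e.1 != e.2.
Proof. by move=> oe; apply/eqP => e12; move: oe; rewrite /oriented e12 ltnn. Qed.

Lemma quiet_edge k y z : quiet k (edge y z).1 (edge y z).2 = quiet k y z.
Proof. by rewrite /edge; case: ifP => //= _; rewrite (quietC h clocks). Qed.

Lemma mass_edge k y z : mass k (edge y z).1 (edge y z).2 = mass k y z.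
Proof. by rewrite /edge; case: ifP => //= _; rewrite (mass_sym c_cond h0). Qed.

(** The mask [a] selects the edges and cells required to be quiet. Intersections correspond to
    disjunctions of masks, so these events form a pi-system, and their probabilities are
    products. *)
Definition cylinder n (a : V * V -> nat -> bool) : set Omega :=
  \bigcap_(e in [set` edges W]) \bigcap_(k < n)
    if a e k then quiet k e.1 e.2 else setT.

Let quiet_if k (b : bool) e : oriented e ->
  measurable (if b then quiet k e.1 e.2 else setT).
Proof.
by move=> /oriented_neq oe; case: b => //; apply: (measurable_quiet h0 clocks).
Qed.

Let edgesP e : [set` edges W] e -> oriented e.
Proof. by rewrite /= mem_edges => /and3P[]. Qed.

Lemma measurable_cylinder n a : measurable (cylinder n a).
Proof.
apply: fset_bigcap_measurable => e /edgesP oe.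
by apply: bigcap_measurableType => k _; exact: quiet_if.
Qed.

Lemma prob_cylinder n a : P (cylinder n a) =
  (\prod_(e <- edges W) \prod_(k < n) if a e k then quiet_prob k e.1 e.2 else 1)%:E.
Proof.
have [_ _ [_ indep]] := clocks.
rewrite /cylinder indep //.
- rewrite -prodEFin big_seq [RHS]big_seq; apply: eq_bigr => e eW.
  by rewrite (prob_quiet_times h0 clocks) //; apply/oriented_neq/edgesP.
move=> e eW; have oe := edgesP eW.
have en := oriented_neq oe.
rewrite /sigma_clock.
apply: (@bigcap_measurableType _ (g_sigma_algebraType _)) => k _.
case: (a e k); last exact: (@measurableT _ (g_sigma_algebraType _)).
apply: sub_sigma_algebra; exists (grid h k), (grid h k.+1); split.
  by rewrite (grid_ge0 h0) (grid_homo h0).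
exact: quiet_sigma_rings.
Qed.

Definition layer k (b : V * V -> bool) : set Omega :=
  \bigcap_(e in [set` edges W]) if b e then quiet k e.1 e.2 else setT.

Lemma measurable_layer k b : measurable (layer k b).
Proof. by apply: fset_bigcap_measurable => e /edgesP oe; exact: quiet_if. Qed.

Lemma cylinder_layer n a b : cylinder n a `&` layer n b =
  cylinder n.+1 (fun e k => if (k < n)%N then a e k else b e).
Proof.
apply/seteqP; split => w /=.
  move=> [wa wb] e eW k /= kn; case: ltnP => kn'; first exact: wa.
  have -> : k = n by apply/eqP; rewrite eqn_leq kn' -ltnS kn.
  exact: wb.
move=> wab; split=> e eW.
  by move=> k /= kn; have := wab e eW k; rewrite /= ltnS (ltnW kn) kn; exact.
by have := wab e eW n; rewrite /= ltnn; apply.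
Qed.

Lemma layer_cylinder n k b : (k < n)%N ->
  layer k b = cylinder n (fun e j => (j == k) && b e).
Proof.
move=> kn; apply/seteqP; split => w /= wb e eW.
  by move=> j /= jn; case: eqP => [->/=|//]; exact: wb.
by have := wb e eW k kn; rewrite eqxx.
Qed.

Lemma prob_layer k b : P (layer k b) =
  (\prod_(e <- edges W) if b e then quiet_prob k e.1 e.2 else 1)%:E.
Proof.
rewrite (layer_cylinder b (ltnSn k)) prob_cylinder; congr EFin.
apply: eq_bigr => e _; rewrite (bigD1 ord_max) //= eqxx /= big1 ?mulr1 // => j.
by rewrite -val_eqE /= => /negbTE ->.
Qed.

(** Not the full history of the clocks, but only the record of which edges of W were quiet in the
    first n cells; the events [reach] are Boolean combinations of these. *)
Definition past n : set (set Omega) := <<s range (cylinder n) >>.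

Lemma past_layer n k b : (k < n)%N -> past n (layer k b).
Proof.
by move=> kn; apply: sub_sigma_algebra; rewrite (layer_cylinder b kn); eexists.
Qed.

Lemma pastS n : past n `<=` past n.+1.
Proof.
apply: smallest_sub; first exact: smallest_sigma_algebra.
move=> _ [a _ <-]; apply: sub_sigma_algebra.
exists (fun e k => (k < n)%N && a e k) => //.
apply/seteqP; split => w wa e eW k /= kn.
  by have := wa e eW k; rewrite /= kn; apply; exact: ltnW.
by case: ltnP => //= kn'; exact: wa.
Qed.

Lemma past_measurable n : past n `<=` measurable.
Proof.
apply: smallest_sub; first exact: sigma_algebra_measurable.
by move=> _ [a _ <-]; exact: measurable_cylinder.
Qed.

(** A cylinder meets a layer of cell n in a longer cylinder, whose product formula splits off the
    factors of that cell; the pi-system argument extends this to the whole of [past n]. *)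
Lemma past_indep n A b : past n A ->
  P (A `&` layer n b) = (P A * P (layer n b))%E.
Proof.
apply: indep_g_sigma_algebra; last 2 first.
- exact: measurable_layer.
- move=> _ [a _ <-]; rewrite cylinder_layer !prob_cylinder prob_layer -EFinM.
  rewrite -big_split; congr EFin; apply: eq_bigr => e _ /=.
  rewrite big_ord_recr /= ltnn; congr (_ * _); apply: eq_bigr => k _.
  by rewrite ltn_ord.
- by move=> _ [a _ <-]; exact: measurable_cylinder.
move=> _ _ [a _ <-] [b' _ <-]; exists (fun e k => a e k || b' e k) => //.
apply/seteqP; split => w /=.
  move=> wab; split => e eW k kn; have := wab e eW k kn.
    by case: (a e k).
  by case: (b' e k); rewrite ?orbT.
move=> [wa wb] e eW k kn; have := wa e eW k kn; have := wb e eW k kn.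
by case: (a e k); case: (b' e k).
Qed.

Lemma quiet_layer k y z : y \in W -> z \in W -> y != z ->
  quiet k y z = layer k (pred1 (edge y z)).
Proof.
move=> yW zW yz; rewrite -quiet_edge; apply/seteqP; split => w /= wq.
  by move=> e eW /=; case: eqP => [->|].
by have := wq _ (edge_edges yW zW yz); rewrite /= eqxx.
Qed.

Definition still k z : set Omega := layer k (incident z).

Lemma prob_still k z : z \in W ->
  P (still k z) = (expR (- \sum_(y <- W | y != z) mass k z y))%:E.
Proof.
move=> zW; rewrite prob_layer -big_mkcond -big_filter; congr EFin.
rewrite (perm_big _ (perm_incident uW zW)) big_map big_filter.
rewrite -sumrN expR_sum; apply: eq_bigr => y _.
by rewrite /quiet_prob mass_edge.
Qed.

Lemma past_busy n A y z : y \in W -> z \in W -> y != z -> past n A ->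
  (P (A `&` ~` quiet n y z) <= P A * (mass n y z)%:E)%E.
Proof.
move=> yW zW yz pA; have mA := past_measurable pA.
have mq : measurable (quiet n y z) by exact: (measurable_quiet h0 clocks yz).
have -> : P (A `&` ~` quiet n y z) = (P A - P (A `&` quiet n y z))%E.
  by rewrite -setDE; apply: measureD => //; rewrite ltey_eq fin_num_measure.
have -> : P (A `&` quiet n y z) = (P A * (quiet_prob n y z)%:E)%E.
  rewrite -(prob_quiet h0 clocks yz) quiet_layer //; exact: past_indep.
rewrite -[P A]fineK ?fin_num_measure // -!EFinM -EFinB lee_fin.
rewrite -[X in X - _]mulr1 -mulrBr ler_wpM2l ?fine_ge0 //.
by have := expR_ge1Dx (- mass n y z); rewrite /quiet_prob; lra.
Qed.

End grid_events.

(** * Events containing the killed walk *)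

Lemma measure_bigsetU_le d (T : measurableType d) (R : realType)
    (mu : {measure set T -> \bar R}) (I : eqType) (s : seq I) (Q : pred I) (F : I -> set T) :
  (forall i, i \in s -> Q i -> measurable (F i)) ->
  (mu (\big[setU/set0]_(i <- s | Q i) F i) <= \sum_(i <- s | Q i) mu (F i))%E.
Proof.
elim: s => [|i s IH] mF; first by rewrite !big_nil measure0.
have mFs j : j \in s -> Q j -> measurable (F j).
  by move=> js; apply: mF; rewrite inE js orbT.
rewrite !big_cons; case: ifPn => Qi; last exact: IH.
apply: (le_trans (measureU2 _ _ _)).
- by apply: mF => //; rewrite mem_head.
- by rewrite big_seq_cond; apply: bigsetU_measurable => j /andP[js]; exact: mFs.
by rewrite leeD2l // IH.
Qed.

Section reach.
Context {R : realType} {V : countType} (c : R -> V -> V -> R).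
Hypothesis c_cond : forall t, 0 <= t -> conductances (c t).
Hypothesis c_ndecr : forall s t u v, 0 <= s -> s <= t -> c s u v <= c t u v.
Variable h : R.
Hypothesis h0 : 0 < h.
Context d (Omega : measurableType d) (P : probability Omega R).
Variable clock : V -> V -> Omega -> set R.
Hypothesis clocks : edge_clocks P c clock.
Variables B B' : seq V.
Hypothesis uW : uniq (B ++ B').

Local Notation W := (B ++ B').
Local Notation quiet := (quiet h clock).
Local Notation mass := (mass c h).
Local Notation still := (still h clock W).
Local Notation past := (past h clock W).

Let BW y : y \in B -> y \in W. Proof. by rewrite mem_cat => ->. Qed.

(* Away from [collision], [reach n z] contains the event that the walk has not
   left B by time [grid n] and is then at z; only this inclusion is needed. *)
Fixpoint reach (x : V) n z : set Omega :=
  if n is k.+1 then (reach x k z `&` still k z) `|`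
    \big[setU/set0]_(y <- B | y != z) (reach x k y `&` ~` quiet k y z)
  else if z == x then setT else set0.

(** The value 0 outside B encodes the killing: it makes [laplacian] over W count the rate from B to
    B' as a loss. *)
Definition reach_prob x n z : R := if z \in B then fine (P (reach x n z)) else 0.

Lemma past_reach x n z : z \in B -> past n (reach x n z).
Proof.
have mpast k A := erefl :
  @measurable _ (g_sigma_algebraType (range (cylinder h clock W k))) A = past k A.
elim: n z => [|n IH] z zB /=.
  by case: ifP => _; rewrite -mpast.
have IH' y : y \in B -> past n.+1 (reach x n y) by move=> yB; apply: pastS; exact: IH.
rewrite -mpast; apply: measurableU.
  apply: measurableI; rewrite mpast; [exact: IH'|exact: past_layer].
rewrite big_seq_cond; apply: bigsetU_measurable => y /andP[yB yz].
apply: measurableI; first exact: IH'.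
apply: measurableC; rewrite mpast (quiet_layer h clocks n (BW yB) (BW zB) yz).
exact: past_layer.
Qed.

Lemma measurable_reach x n z : z \in B -> measurable (reach x n z).
Proof. by move=> zB; apply: (past_measurable h0 clocks (W := W)); exact: past_reach. Qed.

Lemma reach_prob_ge0_le1 x n z : 0 <= reach_prob x n z <= 1.
Proof.
rewrite /reach_prob; case: ifP => zB; last by rewrite lexx ler01.
rewrite fine_ge0 //= -lee_fin fineK ?fin_num_measure //; last exact: measurable_reach.
exact/probability_le1/measurable_reach.
Qed.

Lemma reach_probE x n z : z \in B -> P (reach x n z) = (reach_prob x n z)%:E.
Proof.
by move=> zB; rewrite /reach_prob zB fineK // fin_num_measure //; exact: measurable_reach.
Qed.

Lemma reach_prob0 x z : x \in B -> reach_prob x 0 z = (z == x)%:R.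
Proof.
move=> xB; rewrite /reach_prob /=; case: eqVneq => [->|_].
  by rewrite xB probability_setT.
by rewrite measure0; case: ifP.
Qed.

Variable Lambda : R.
Hypothesis Lambda_mass : forall k z, z \in W ->
  \sum_(y <- W | y != z) mass k z y <= h * Lambda.
Hypothesis hLambda : h * Lambda <= 1.

(** Union bound over staying at z and entering it from some y in B. By independence these contribute
    u(z) exp (- mu) and at most u(y) times the mass of the edge; the quadratic term is the
    second-order error of the exponential. *)
Lemma reach_probS x n z : z \in B ->
  reach_prob x n.+1 z <= reach_prob x n z - laplacian W (mass n) (reach_prob x n) z
    + (h * Lambda) ^+ 2.
Proof.
move=> zB; rewrite -lee_fin -reach_probE //=.
have mr y : y \in B -> measurable (reach x n y) by exact: measurable_reach.
have mq y : y != z -> measurable (~` quiet n y z).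
  by move=> yz; apply: measurableC; exact: (measurable_quiet h0 clocks).
have ms : measurable (still n z) by exact: (measurable_layer h0 clocks).
set still_z := reach x n z `&` still n z.
set enter_z := \big[setU/set0]_(y <- B | y != z) _.
have U : (P (still_z `|` enter_z) <= P still_z + P enter_z)%E.
  apply: measureU2; first by apply: measurableI => //; exact: mr.
  rewrite /enter_z big_seq_cond; apply: bigsetU_measurable => y /andP[yB yz].
  by apply: measurableI; [exact: mr|exact: mq].
apply: (le_trans U) => {U}.
set mu := \sum_(y <- W | y != z) mass n z y.
have mu0 : 0 <= mu by apply: sumr_ge0 => y _; exact: (mass_ge0 c_cond c_ndecr h0).
have muL : mu <= h * Lambda by apply: Lambda_mass; exact: BW.
have h1 : P still_z = (reach_prob x n z * expR (- mu))%:E.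
  rewrite (past_indep h0 clocks) ?(prob_still c_cond h0 clocks uW) ?BW //;
    last exact: past_reach.
  by rewrite reach_probE.
have h2 : (P enter_z <=
   (\sum_(y <- B | y != z) reach_prob x n y * mass n z y)%:E)%E.
  apply: le_trans (measure_bigsetU_le _ _) _.
    by move=> y yB yz; apply: measurableI; [exact: mr|exact: mq].
  rewrite -sumEFin big_seq_cond [leRHS]big_seq_cond.
  apply: lee_sum => y /andP[yB yz].
  rewrite EFinM -reach_probE // (mass_sym c_cond h0).
  by apply: (past_busy h0 clocks) => //; [exact: BW|exact: BW|exact: past_reach].
rewrite h1; apply: le_trans (leeD2l _ h2) _; rewrite -EFinD lee_fin.
have -> : laplacian W (mass n) (reach_prob x n) z =
    mu * reach_prob x n z - \sum_(y <- B | y != z) reach_prob x n y * mass n z y.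
  have -> : \sum_(y <- B | y != z) reach_prob x n y * mass n z y =
            \sum_(y <- W | y != z) reach_prob x n y * mass n z y.
    rewrite big_cat /= [X in _ = _ + X]big1_seq ?addr0 // => y /andP[_ yB'].
    rewrite /reach_prob ifF ?mul0r //; apply/negbTE; move: uW.
    rewrite cat_uniq => /and3P[_ + _]; apply: contra => yB.
    by apply/hasP; exists y.
  rewrite /laplacian mulr_suml -sumrB [in RHS]big_mkcond; apply: eq_bigr => y _.
  by case: eqVneq => [->|_] /=; [rewrite subrr mulr0|ring].
have /andP[u0 u1] := reach_prob_ge0_le1 x n z.
(* Through exp (- mu) <= 1 / (1 + mu) and (1 - mu + mu^2) (1 + mu) = 1 + mu^3. *)
have e1 : expR (- mu) <= 1 - mu + mu ^+ 2.
  rewrite expRN -[leLHS]mul1r ler_pdivrMr ?expR_gt0 //.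
  apply: (@le_trans _ _ ((1 - mu + mu ^+ 2) * (1 + mu))).
    by rewrite (_ : _ * _ = 1 + mu ^+ 3); [rewrite lerDl exprn_ge0|ring].
  rewrite ler_wpM2l ?expR_ge1Dx // addr_ge0 ?sqr_ge0 // subr_ge0.
  exact: le_trans hLambda.
have : reach_prob x n z * expR (- mu) <= reach_prob x n z * (1 - mu + mu ^+ 2).
  by rewrite ler_wpM2l.
have : reach_prob x n z * mu ^+ 2 <= (h * Lambda) ^+ 2.
  apply: (@le_trans _ _ (mu ^+ 2)); first by rewrite ler_piMl // sqr_ge0.
  by rewrite lerXn2r // nnegrE // (le_trans mu0).
lra.
Qed.

Definition collision_at k : set Omega :=
  \big[setU/set0]_(e <- edges W) multiple h clock k e.1 e.2 `|`
  \big[setU/set0]_(e <- edges W) \big[setU/set0]_(e' <- edges W | e' != e)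
    (~` quiet k e.1 e.2 `&` ~` quiet k e'.1 e'.2).

Let edges_neq e : e \in (edges W : seq _) -> e.1 != e.2.
Proof. by rewrite mem_edges => /and3P[/oriented_neq]. Qed.

Let measurable_quiet_edge k e : e \in (edges W : seq _) -> measurable (quiet k e.1 e.2).
Proof. by move=> eW; exact: (measurable_quiet h0 clocks (edges_neq eW)). Qed.

Lemma measurable_collision_at k : measurable (collision_at k).
Proof.
apply: measurableU.
  rewrite big_seq; apply: bigsetU_measurable => e eW.
  exact: (measurable_multiple h0 clocks (edges_neq eW)).
rewrite big_seq; apply: bigsetU_measurable => e eW.
rewrite big_seq_cond; apply: bigsetU_measurable => e' /andP[e'W _].
by apply: measurableI; apply: measurableC; exact: measurable_quiet_edge.
Qed.

Let prob_two_busy k e e' : e \in (edges W : seq _) -> e' \in (edges W : seq _) -> e' != e ->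
  (P (~` quiet k e.1 e.2 `&` ~` quiet k e'.1 e'.2) <=
   (mass k e.1 e.2 * mass k e'.1 e'.2)%:E)%E.
Proof.
move=> eW e'W ee'.
have mQ := measurable_quiet_edge k eW.
have mQ' := measurable_quiet_edge k e'W.
set Q := quiet k e.1 e.2 in mQ *; set Q' := quiet k e'.1 e'.2 in mQ' *.
have PQ : P Q = (quiet_prob c h k e.1 e.2)%:E.
  exact: (prob_quiet h0 clocks (edges_neq eW)).
have PQ' : P Q' = (quiet_prob c h k e'.1 e'.2)%:E.
  exact: (prob_quiet h0 clocks (edges_neq e'W)).
have PQQ' : P (Q `&` Q') = (quiet_prob c h k e.1 e.2 * quiet_prob c h k e'.1 e'.2)%:E.
  have -> : Q `&` Q' = layer h clock W k (pred2 e e').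
    apply/seteqP; split => w /=.
      move=> [wQ wQ'] a _ /=; case: eqP => [->|_] /=; first exact: wQ.
      by case: eqP => [->|].
    by move=> wb; split; [have := wb _ eW|have := wb _ e'W];
      rewrite /= eqxx ?orbT.
  rewrite (prob_layer h0 clocks) (big_fsetD1 e) //= eqxx /=; congr (_ * _)%:E.
  rewrite (big_fsetD1 e') /=; last by rewrite in_fsetD1 ee' e'W.
  rewrite eqxx orbT big_seq big1 ?mulr1 // => a.
  by rewrite !in_fsetD1 => /and3P[/negbTE -> /negbTE -> _].
have PU : P (Q `|` Q') = (quiet_prob c h k e.1 e.2 + quiet_prob c h k e'.1 e'.2 -
    quiet_prob c h k e.1 e.2 * quiet_prob c h k e'.1 e'.2)%:E.
  rewrite EFinB EFinD -PQ -PQ' -PQQ'.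
  by apply: measureUfinr => //; rewrite ltey_eq fin_num_measure.
rewrite -setCU probability_setC; last exact: measurableU.
rewrite [X in (1 - X)%E]PU -EFinB lee_fin.
have m0 := mass_ge0 c_cond c_ndecr h0.
rewrite (_ : 1 - _ = (1 - quiet_prob c h k e.1 e.2) *
  (1 - quiet_prob c h k e'.1 e'.2)); last by ring.
have q1 y z : 0 <= 1 - quiet_prob c h k y z <= mass k y z.
  have := expR_ge1Dx (- mass k y z); rewrite -/(quiet_prob c h k y z) => q.
  rewrite subr_ge0 /quiet_prob -expR0 ler_expR oppr_le0 m0 expR0 /=.
  by rewrite /quiet_prob in q; lra.
by apply: ler_pM; case/andP: (q1 e.1 e.2); case/andP: (q1 e'.1 e'.2).
Qed.

Variable L : R.
Hypothesis L_mass : forall k, \sum_(e <- edges W) mass k e.1 e.2 <= h * L.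

(** S^2 is the double sum of products of masses: its diagonal bounds repeated rings of one clock,
    its off-diagonal part the pairs of distinct edges. Bounding each by all of S^2 gives the factor
    2. *)
Lemma prob_collision_at k : (P (collision_at k) <= (2 * (h * L) ^+ 2)%:E)%E.
Proof.
have m0 := mass_ge0 c_cond c_ndecr h0.
set S := \sum_(e <- edges W) mass k e.1 e.2.
have S0 : 0 <= S by apply: sumr_ge0.
have SL : S ^+ 2 <= (h * L) ^+ 2.
  have SL := L_mass k; apply: lerXn2r => //; rewrite nnegrE //.
  exact: le_trans S0 SL.
have hS2 : S ^+ 2 = \sum_(e <- edges W) \sum_(e' <- edges W) mass k e.1 e.2 * mass k e'.1 e'.2.
  rewrite expr2 {1}/S mulr_suml; apply: eq_bigr => e _.
  by rewrite mulr_sumr.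
have mm e : e \in (edges W : seq _) -> measurable (multiple h clock k e.1 e.2).
  by move=> eW; exact: (measurable_multiple h0 clocks (edges_neq eW)).
have mb e e' : e \in (edges W : seq _) -> e' \in (edges W : seq _) ->
  measurable (~` quiet k e.1 e.2 `&` ~` quiet k e'.1 e'.2).
  by move=> eW e'W; apply: measurableI; apply: measurableC; exact: measurable_quiet_edge.
have mbb e : e \in (edges W : seq _) ->
  measurable (\big[setU/set0]_(e' <- edges W | e' != e)
    (~` quiet k e.1 e.2 `&` ~` quiet k e'.1 e'.2)).
  move=> eW; rewrite big_seq_cond; apply: bigsetU_measurable => e' /andP[e'W _].
  exact: mb.
apply: le_trans (measureU2 _ _ _) _.
- by rewrite big_seq; apply: bigsetU_measurable => e; exact: mm.
- by rewrite big_seq; apply: bigsetU_measurable => e; exact: mbb.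
apply: (@le_trans _ _ ((S ^+ 2)%:E + (S ^+ 2)%:E)%E); last first.
  by rewrite -EFinD lee_fin; lra.
apply: leeD.
  apply: le_trans (measure_bigsetU_le _ _) _ => [e eW _|]; first exact: mm.
  apply: (@le_trans _ _ (\sum_(e <- edges W) (mass k e.1 e.2 ^+ 2)%:E)%E).
    rewrite big_seq [leRHS]big_seq; apply: lee_sum => e eW.
    exact: (prob_multiple c_cond c_ndecr h0 clocks (edges_neq eW)).
  rewrite sumEFin lee_fin hS2 big_seq [leRHS]big_seq; apply: ler_sum => e eW.
  by rewrite (big_fsetD1 e) //= expr2 lerDl; apply: sumr_ge0 => e' _; exact: mulr_ge0.
apply: le_trans (measure_bigsetU_le _ _) _ => [e eW _|]; first exact: mbb.
rewrite hS2 -sumEFin big_seq [leRHS]big_seq; apply: lee_sum => e eW.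
apply: le_trans (measure_bigsetU_le _ _) _ => [e' e'W _|]; first exact: mb.
apply: (@le_trans _ _ (\sum_(e' <- edges W | e' != e)
  (mass k e.1 e.2 * mass k e'.1 e'.2)%:E)%E).
  rewrite big_seq_cond [leRHS]big_seq_cond; apply: lee_sum => e' /andP[e'W ee'].
  exact: prob_two_busy.
rewrite sumEFin lee_fin big_mkcond; apply: ler_sum => e' _.
by case: ifP => // _; exact: mulr_ge0.
Qed.

Definition collision n : set Omega := \big[setU/set0]_(k < n) collision_at k.

Lemma measurable_collision n : measurable (collision n).
Proof. by apply: bigsetU_measurable => k _; exact: measurable_collision_at. Qed.

Lemma prob_collision n : (P (collision n) <= (n%:R * (2 * (h * L) ^+ 2))%:E)%E.
Proof.
apply: le_trans (measure_bigsetU_le _ _) _ => [k _ _|].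
  exact: measurable_collision_at.
apply: (@le_trans _ _ (\sum_(k < n) (2 * (h * L) ^+ 2)%:E)%E).
  by apply: lee_sum => k _; exact: prob_collision_at.
by rewrite sumEFin sumr_const card_ord lee_fin -[leLHS]mulr_natl.
Qed.

Lemma no_collision n k w y z y' z' s t : (k < n)%N -> ~ collision n w ->
  y \in W -> z \in W -> y != z -> y' \in W -> z' \in W -> y' != z' ->
  clock y z w s -> clock y' z' w t -> cell h k s -> cell h k t -> s = t.
Proof.
move=> kn ncol yW zW yz y'W z'W yz' ys yt ks kt.
apply/eqP/negP => /negP st; apply: ncol.
rewrite /collision -bigcup_mkord; exists k => //.
have eW := edge_edges yW zW yz; have e'W := edge_edges y'W z'W yz'.
have [ee|ee] := eqVneq (edge y' z') (edge y z).
  left; rewrite -bigcup_seq; exists (edge y z) => //=.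
  have cE a b : clock a b w = clock (edge a b).1 (edge a b).2 w.
    by case: clocks => cs _ _; rewrite /edge; case: ifP => //= _; rewrite cs.
  apply: (two_rings_multiple (s := s) (t := t)) => //; first by rewrite -cE.
  by rewrite -ee -cE.
right; rewrite -bigcup_seq; exists (edge y z) => //=.
rewrite -bigcup_seq_cond; exists (edge y' z'); first by rewrite /= e'W.
rewrite !(quiet_edge h clocks); split => /seteqP[q _].
  by apply: (q s).
by apply: (q t).
Qed.

End reach.

(** * Paths driven by the clocks *)

Section driven_path.
Context {R : realType} {V : countType}.
Variables (ring : V -> V -> set R) (x : V) (Y : nat -> V) (T : nat -> \bar R).
Hypothesis drv : driven_by ring x Y T.
Local Open Scope ereal_scope.

Lemma jump_time_lt n : T n < +oo -> T n < T n.+1.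
Proof.
move=> Tn; have [_ _ /(_ n) [[_ ->//]|[t [-> + _ _ _]]]] := drv.
by [].
Qed.

Lemma jump_time_infty n : T n = +oo -> T n.+1 = +oo.
Proof.
move=> Tn; have [_ _ /(_ n) [[_ ->//]|[t [_ + _ _ _]]]] := drv.
by rewrite Tn.
Qed.

Lemma jump_time_leS n : T n <= T n.+1.
Proof.
have [Tn|Tn] := ltP (T n) +oo; first exact/ltW/jump_time_lt.
by rewrite (jump_time_infty (n := n)) ?leey //; apply/eqP; rewrite -leye_eq.
Qed.

Lemma jump_time_le : {homo T : m n / (m <= n)%N >-> m <= n}.
Proof. by apply/nondecreasing_seqP => n; exact: jump_time_leS. Qed.

Lemma jump_time_gt m n : (m < n)%N -> T m < +oo -> T m < T n.
Proof. by move=> mn /jump_time_lt /lt_le_trans; apply; exact: jump_time_le. Qed.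

Lemma jump_time_ge0 n : 0 <= T n.
Proof. by have [_ <- _] := drv; exact: jump_time_le. Qed.

Lemma jump n t : T n.+1 = t%:E -> Y n.+1 != Y n /\ ring (Y n) (Y n.+1) t.
Proof.
have [_ _ /(_ n) [[_ ->//]|[s [-> _ yy rs _] [<-]]]] := drv.
by [].
Qed.

Lemma no_ring_between_jumps n z t : T n < t%:E -> t%:E < T n.+1 -> z != Y n ->
  ~ ring (Y n) z t.
Proof.
move=> tn tn1 zn rt; have ra : rings_after ring (Y n) (T n) t.
  by split=> //; exists z.
have [_ _ /(_ n) [[r0 _]|[s [Ts _ _ _ smin]]]] := drv.
  by rewrite r0 in ra.
by move: tn1; rewrite Ts lte_fin ltNge smin.
Qed.

(** Since t precedes a given jump time, the search for the current jump is finite, whether or not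
    the walk explodes. *)
Lemma exists_current_jump n t : 0 <= t%:E -> t%:E < T n.+1 ->
  exists2 m, (m <= n)%N & T m <= t%:E < T m.+1.
Proof.
move=> t0; elim: n => [|n IH] tn.
  by exists 0%N => //; rewrite tn andbT; have [_ -> _] := drv.
have [Tn|Tn] := leP (T n.+1) t%:E; first by exists n.+1; rewrite ?Tn.
by have [m mn] := IH Tn; exists m => //; exact: leqW.
Qed.

Lemma jump_time_real n : T n < +oo -> exists t, T n = t%:E.
Proof.
by move=> Tn; exists (fine (T n)); rewrite fineK // ge0_fin_numE // jump_time_ge0.
Qed.

End driven_path.

Section pathwise.
Context {R : realType} {V : countType} (c : R -> V -> V -> R).
Variable h : R.
Hypothesis h0 : 0 < h.
Context d (Omega : measurableType d) (P : probability Omega R).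
Variable clock : V -> V -> Omega -> set R.
Hypothesis clocks : edge_clocks P c clock.
Variables B B' : seq V.
Variables (x : V) (Y : nat -> V) (T : nat -> \bar R) (w : Omega).
Hypothesis drv : driven_by (fun u v => clock u v w) x Y T.
Variable K : nat.
Hypothesis no_col : ~ collision h clock B B' K w.

Local Notation W := (B ++ B').
Local Notation reach := (reach h clock B B' x).
Local Notation quiet := (quiet h clock).
Local Notation grid := (grid h).

Let BW y : y \in B -> y \in W. Proof. by rewrite mem_cat => ->. Qed.

(* [p] bounds the indices of the path known to stay in B. *)
Lemma one_jump_per_cell p k m n : (k < K)%N ->
  (forall i, (i <= p)%N -> Y i \in B) -> (m < n)%N -> (n < p)%N ->
  ((grid k)%:E < T m.+1)%E -> (T n.+1 <= (grid k.+1)%:E)%E -> False.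
Proof.
move=> kK YB mn np km nk.
have Tmn : (T m.+1 <= T n.+1)%E by apply: (jump_time_le drv); rewrite ltnS ltnW.
have mfin : (T m.+1 < +oo)%E by rewrite (le_lt_trans (le_trans Tmn nk)) ?ltry.
have nfin : (T n.+1 < +oo)%E by rewrite (le_lt_trans nk) ?ltry.
have [s Ts] := jump_time_real drv mfin; have [t Tt] := jump_time_real drv nfin.
have := jump_time_gt drv (_ : m.+1 < n.+1)%N mfin; rewrite ltnS => /(_ mn).
rewrite Ts Tt lte_fin; rewrite Ts Tt lee_fin in Tmn.
rewrite Ts lte_fin in km; rewrite Tt lee_fin in nk.
have [yms rs] := jump drv Ts; have [ynt rt] := jump drv Tt.
rewrite (_ : s = t) ?ltxx //.
apply: (no_collision clocks kK no_col _ _ _ _ _ _ rs rt); rewrite 1?eq_sym //.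
- by apply/BW/YB; rewrite ltnW // (ltn_trans mn).
- by apply/BW/YB; rewrite (ltn_trans _ np).
- by apply/BW/YB; rewrite ltnW.
- exact/BW/YB.
- by rewrite /cell /= in_itv /= km (le_trans Tmn).
- by rewrite /cell /= in_itv /= nk (lt_le_trans km).
Qed.

(** Induction on k, comparing the index m of the walk at [grid k] with its index n one cell later: m
    = n gives [still], n = m + 1 gives a ring on the edge from [Y m], and a larger n would put two
    jumps into one cell. *)
Lemma walk_reach k n : (k <= K)%N -> (T n <= (grid k)%:E < T n.+1)%E ->
  (forall i, (i <= n)%N -> Y i \in B) -> reach k (Y n) w.
Proof.
have [Y0 T0 _] := drv.
elim: k n => [|k IH] n kK /andP[Tn nT] YB.
  case: n Tn {nT YB} => [|n]; first by rewrite Y0 /= eqxx.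
  have -> : (grid 0)%:E = T 0%N by rewrite T0 /grid mul0r.
  rewrite leNgt => /negP[].
  by apply: (jump_time_gt drv) => //; rewrite T0.
have kk : grid k < grid k.+1 by rewrite gridS ltrDl.
have kn : ((grid k)%:E < T n.+1)%E by rewrite (lt_trans _ nT) // lte_fin.
have [|m mn Tm] := exists_current_jump drv _ kn; first by rewrite lee_fin grid_ge0.
have rm : reach k (Y m) w.
  by apply: IH => //; [exact: ltnW|move=> i im; exact/YB/(leq_trans im)].
have [mn'|nm] := ltnP m n; last first.
  have {nm mn} mn : m = n by apply/eqP; rewrite eqn_leq mn.
  rewrite mn in rm Tm; left; split => // e /=.
  rewrite mem_edges => /and3P[oe eW1 eW2]; case: ifPn => //= ie.
  apply/seteqP; split => // t [rt]; rewrite /cell /= in_itv /= => /andP[kt tk].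
  have nt : (T n < t%:E)%E by rewrite (le_lt_trans (proj1 (andP Tm))) ?lte_fin.
  have tn : (t%:E < T n.+1)%E by rewrite (le_lt_trans _ nT) ?lee_fin.
  have ne := oriented_neq oe.
  case/orP: ie => /eqP ie.
    apply: (no_ring_between_jumps drv nt tn (z := e.2)); last by rewrite -ie.
    by rewrite -ie eq_sym.
  apply: (no_ring_between_jumps drv nt tn (z := e.1)); first by rewrite -ie.
  by case: clocks => cs _ _; rewrite -ie cs.
have [mn2|nm2] := ltnP m.+1 n.
  exfalso; case: n mn2 Tn {kn nT mn mn'} YB => // n mn2 Tn YB.
  apply: (one_jump_per_cell (k := k) (m := m) (n := n) (p := n.+1) kK YB) => //.
  by case/andP: Tm.
have {nm2 mn'} nE : n = m.+1 by apply/eqP; rewrite eqn_leq nm2.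
rewrite nE in Tn YB *.
have Tfin : (T m.+1 < +oo)%E by rewrite (le_lt_trans Tn) ?ltry.
have [t Tt] := jump_time_real drv Tfin.
have [yt rt] := jump drv Tt.
right; rewrite -bigcup_seq_cond; exists (Y m).
  by rewrite /= YB ?leqnSn //= eq_sym.
split=> // /seteqP[q _]; apply: (q t); split => //.
move: Tm Tn; rewrite Tt lte_fin lee_fin => /andP[_ kt] tk.
by rewrite /cell /= in_itv /= kt.
Qed.

Lemma exists_cell (t : \bar R) : (0 < t <= (grid K)%:E)%E ->
  exists2 k, (k < K)%N & ((grid k)%:E < t <= (grid k.+1)%:E)%E.
Proof.
elim: K => [|n IH] /andP[t0 tK].
  by move: (lt_le_trans t0 tK); rewrite /grid mul0r ltxx.
have [tn|nt] := leP t (grid n)%:E; last by exists n; rewrite ?nt.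
have [|k kn kP] := IH; first by rewrite t0.
by exists k => //; exact: ltnW.
Qed.

Lemma departure_reach v n : Y n = v -> (forall i, (i <= n.+1)%N -> Y i \in B) ->
  (T n.+1 <= (grid K)%:E)%E ->
  exists k : 'I_K, [/\ ((grid k)%:E < T n.+1 <= (grid k.+1)%:E)%E &
   exists2 y, (y \in B) && (y != v) & (reach k v `&` ~` quiet k v y) w].
Proof.
move=> Yn YB TK.
have T0 : (0 < T n.+1)%E.
  have [_ T0 _] := drv.
  by rewrite -T0; apply: (jump_time_gt drv) => //; rewrite T0.
have [|k kK /andP[kt tk]] := @exists_cell (T n.+1); first by rewrite T0.
exists (Ordinal kK); split; first by rewrite /= kt.
have [|m mn Tm] := exists_current_jump drv _ kt; first by rewrite lee_fin grid_ge0.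
(* An earlier index at [grid k] would put two jumps into this cell. *)
have mE : m = n.
  apply/eqP; rewrite eqn_leq mn leqNgt; apply/negP => mn'.
  apply: (one_jump_per_cell (k := k) (m := m) (n := n) (p := n.+1)) => //.
  by case/andP: Tm.
rewrite mE in Tm.
have Tfin : (T n.+1 < +oo)%E by rewrite (le_lt_trans TK) ?ltry.
have [t Tt] := jump_time_real drv Tfin.
have [yt rt] := jump drv Tt.
exists (Y n.+1); first by rewrite YB //= -Yn.
split; rewrite -Yn.
  by apply: walk_reach => //; [exact: ltnW|move=> i iN; apply: YB; exact: leqW].
move=> /seteqP[q _]; apply: (q t); split => //.
by move: kt tk; rewrite Tt lte_fin lee_fin /cell /= in_itv /= => -> ->.
Qed.

(** Sending a departure to its cell is injective, as a cell holds at most one jump. Cells can be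
    counted through events of [reach], whose probabilities are under control. *)
Lemma departures_le v M :
  (#|[set n : 'I_M | `[< [/\ Y n = v, forall i, (i <= n.+1)%N -> Y i \in B &
     (T n.+1 <= (grid K)%:E)%E] >]]%SET| <=
   #|[set k : 'I_K | `[< exists2 y, (y \in B) && (y != v) &
     (reach k v `&` ~` quiet k v y) w >]]%SET|)%N.
Proof.
set A := [set n : 'I_M | _]%SET.
have [->|[n0 n0A]] := set_0Vmem A; first by rewrite cards0.
(* A default cell, the value of the choice function outside A. *)
have K0 : 'I_K.
  move: n0A; rewrite inE => /asboolP[Yn YB TK].
  by have [k _] := cid (departure_reach Yn YB TK).
have cellP (n : 'I_M) : exists k : 'I_K, n \in A ->
   ((grid k)%:E < T n.+1 <= (grid k.+1)%:E)%E /\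
   exists2 y, (y \in B) && (y != v) & (reach k v `&` ~` quiet k v y) w.
  have [nA|nA] := boolP (n \in A); last by exists K0.
  move: (nA); rewrite inE => /asboolP[Yn YB TK].
  by have [k [? ?]] := departure_reach Yn YB TK; exists k.
have [f fP] := choice cellP.
have finj : {in A &, injective f}.
  suff lt (m n : 'I_M) : m \in A -> n \in A -> f m = f n -> (m < n)%N -> False.
    move=> m n mA nA fmn; apply/val_inj/eqP.
    have [mn|mn|//] := ltngtP; exfalso; first exact: (lt m n).
    exact: (lt n m).
  move=> mA nA fmn mn.
  have [/andP[km _] _] := fP _ mA; have [/andP[_ nk] _] := fP _ nA.
  move: nA; rewrite inE => /asboolP[_ YB _].
  apply: (one_jump_per_cell (k := f n) (m := m) (n := n) (p := n.+1)) => //.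
  by rewrite -fmn.
rewrite -(card_in_imset finj); apply: subset_leq_card.
apply/fintype.subsetP => k /imsetP[n nA ->].
by rewrite inE; apply/asboolP; have [] := fP _ nA.
Qed.

(** The walk was at v when the cell began, or it arrived during the cell and an edge at v rang. The
    second event has probability O(h), so over O(1/h) cells of length h it adds a time O(h). *)
Lemma occupation_cover v n t k : (k < K)%N -> Y n = v ->
  (forall i, (i <= n)%N -> Y i \in B) ->
  (T n <= t%:E < T n.+1)%E -> grid k <= t < grid k.+1 ->
  reach k v w \/ exists2 y, (y \in B) && (y != v) & (~` quiet k v y) w.
Proof.
move=> kK Yn YB /andP[nt tn] /andP[kt tk].
have kn : ((grid k)%:E < T n.+1)%E by rewrite (le_lt_trans _ tn).
have [nk|{}kn] := leP (T n) (grid k)%:E.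
  by left; rewrite -Yn; apply: walk_reach => //; [exact: ltnW|rewrite nk].
right; case: n => [|n] in Yn YB nt tn kn *.
  by have [_ T0 _] := drv; move: kn; rewrite T0 lte_fin ltNge grid_ge0.
have Tfin : (T n.+1 < +oo)%E by rewrite (le_lt_trans nt) ?ltry.
have [s Ts] := jump_time_real drv Tfin.
have [ys rs] := jump drv Ts.
exists (Y n); first by rewrite YB // -Yn eq_sym.
move=> /seteqP[q _]; apply: (q s); split.
  by case: clocks => cs _ _; rewrite -Yn cs.
move: kn nt; rewrite Ts lte_fin lee_fin /cell /= in_itv /= => -> /le_trans; apply.
exact: ltW.
Qed.

End pathwise.

(** * Expected visits and local time *)

Section expectation.
Context d (T : measurableType d) (R : realType) (P : probability T R).

Lemma integral_sum_indic M (A : nat -> set T) : (forall n, measurable (A n)) ->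
  (\int[P]_w \sum_(n < M) (\1_(A n) w)%:E = \sum_(n < M) P (A n))%E.
Proof.
move=> mA; rewrite ge0_integral_sum //.
- by apply: eq_bigr => n _; rewrite integral_indic // setIT.
- by move=> n; apply/measurable_EFinP; exact: measurable_indic.
Qed.

Lemma integral_le_events (f : T -> \bar R) (a b : R) K (G : 'I_K -> set T) (C : set T) :
  measurable_fun [set: T] f -> (forall w, 0 <= f w)%E -> 0 <= a -> 0 <= b ->
  (forall k, measurable (G k)) -> measurable C ->
  (forall w, f w <= (\sum_(k < K) a * \1_(G k) w + b * \1_C w)%:E)%E ->
  (\int[P]_w f w <= a%:E * \sum_(k < K) P (G k) + b%:E * P C)%E.
Proof.
move=> mf f0 a0 b0 mG mC le_f.
have mI (D : set T) r : measurable D -> measurable_fun setT (fun w => (r * \1_D w)%:E : \bar R).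
  move=> mD; apply/measurable_EFinP; apply: measurable_funM => //.
have i0 (D : set T) r w : 0 <= r -> (0 <= (r * \1_D w)%:E :> \bar R)%E.
  by move=> r0; rewrite lee_fin mulr_ge0.
have iI (D : set T) r : 0 <= r -> measurable D ->
    (\int[P]_w (r * \1_D w)%:E = r%:E * P D)%E.
  move=> r0 mD; rewrite (eq_integral (fun w => r%:E * (\1_D w)%:E)%E); last first.
    by move=> w _; rewrite EFinM.
  rewrite ge0_integralZl_EFin //.
    by rewrite integral_indic // setIT.
  by apply/measurable_EFinP; exact: measurable_indic.
apply: (@le_trans _ _ (\int[P]_w (\sum_(k < K) (a * \1_(G k) w)%:E + (b * \1_C w)%:E))%E).
  apply: ge0_le_integral => //.
    by apply: emeasurable_funD; [apply: emeasurable_sum => k|]; exact: mI.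
  by move=> w _; rewrite sumEFin -EFinD.
rewrite ge0_integralD //=; last 4 first.
- by move=> w _; apply: sume_ge0 => k _; exact: i0.
- by apply: emeasurable_sum => k; exact: mI.
- by move=> w _; exact: i0.
- exact: mI.
rewrite iI // ge0_integral_sum //=; last 2 first.
- by move=> k; exact: mI.
- by move=> k w _; exact: i0.
rewrite ge0_sume_distrr //; apply: leeD => //.
by apply: lee_sum => k _; rewrite iI.
Qed.

End expectation.

(** The integral of a nonnegative function is the supremum over the simple functions below it, hence
    monotone without measurability. Thus [nb_visits] and [local_time] can be bounded directly. *)
Lemma ge0_le_integral_nomeas d (T : measurableType d) (R : realType)
    (mu : {measure set T -> \bar R}) (f g : T -> \bar R) :
  (forall w, 0 <= f w)%E -> (forall w, f w <= g w)%E ->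
  (\int[mu]_w f w <= \int[mu]_w g w)%E.
Proof.
move=> f0 fg; have g0 w : (0 <= g w)%E by exact: le_trans (fg w).
rewrite !ge0_integralTE //; apply: ereal_sup_le => _ [s sf <-].
by exists s => // w; exact: le_trans (sf w) (fg w).
Qed.

Lemma lee_harmonic (R : realType) (a : \bar R) (b C : R) :
  (\forall j \near \oo, (a <= (b + C / j%:R)%:E)%E) -> (a <= b%:E)%E.
Proof.
move=> [j0 _ h]; apply/lee_addgt0Pr => e e0.
pose j := maxn j0.+1 (Num.truncn (C / e)).+1.
have j_gt : C / e < j%:R.
  by apply: (lt_le_trans (truncnS_gt _)); rewrite ler_nat leq_maxr.
have jpos : 0 < j%:R :> R by rewrite ltr0n leq_max ltn0Sn.
apply: (le_trans (h j _)); first by rewrite /= /j leq_max leqnSn.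
rewrite -EFinD lee_fin lerD2l ler_pdivrMr //.
by move: j_gt; rewrite ltr_pdivrMr // mulrC => /ltW.
Qed.

(** * Choice of the mesh and of the error constants *)

Section finite_domain.
Context {R : realType} {V : countType} (c : R -> V -> V -> R) (cinf : V -> V -> R).
Hypothesis c_cond : forall t, 0 <= t -> conductances (c t).
Hypothesis c_ndecr : forall s t u v, 0 <= s -> s <= t -> c s u v <= c t u v.
Hypothesis c_lim : forall u v, c t u v @[t --> +oo] --> cinf u v.
Hypothesis cinf_fin : forall v, (total_conductance cinf v < +oo)%E.
Hypothesis c0_trans : rw_transient (c 0).
Context d (Omega : measurableType d) (P : probability Omega R).

Lemma c_le_lim t y z : 0 <= t -> c t y z <= cinf y z.
Proof.
move=> t0; rewrite leNgt; apply/negP => ltc.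
have near_lt : \forall s \near +oo, c s y z < c t y z.
  by apply: (cvgr_lt _ (c_lim (u := y) (v := z))).
have near_ge : \forall s \near +oo, t <= s.
  by apply: nbhs_pinfty_ge; exact: num_real.
have [s [ts sc]] := @filter_ex _ (pinfty_nbhs R) (@proper_pinfty_nbhs R) _
  (filterI near_ge near_lt).
by move: sc; rewrite ltNge c_ndecr.
Qed.

Lemma cinf_ge0 y z : 0 <= cinf y z.
Proof. by apply: le_trans (c_le_lim y z (lexx 0)); case: (c_cond (lexx 0)). Qed.

Lemma mass_le_lim h k y z : 0 < h -> mass c h k y z <= h * cinf y z.
Proof.
move=> h0; apply: (le_trans (mass_le c_cond c_ndecr h0 k y z)).
by rewrite ler_pM2l // c_le_lim // grid_ge0.
Qed.

Let pi_inf y : R := fine (total_conductance cinf y).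

Lemma sum_cinf_le (s : seq V) y : uniq s -> \sum_(z <- s) cinf y z <= pi_inf y.
Proof.
move=> us; rewrite -lee_fin -sumEFin fineK; first exact: sum_le_esum.
by rewrite ge0_fin_numE //; apply: esum_ge0 => z _; rewrite lee_fin cinf_ge0.
Qed.

Variables (x : V) (clock : V -> V -> Omega -> set R).
Hypothesis clocks : edge_clocks P c clock.
Variable B : seq V.
Hypothesis uB : uniq B.
Hypothesis xB : x \in B.
Variables (v : V) (vB : v \in B).
Variable N : nat.

Let C0 := resistance (c 0) x + resistance (c 0) v.

(** [B'] and [C1] are chosen before the mesh 1/j, so that j can tend to infinity with both fixed;
    [C0] depends neither on B nor on N. *)
Lemma grid_estimate : exists B' C1, [/\ uniq (B ++ B'), 0 <= C1 &
  \forall j \near \oo, [/\ 0 < (j%:R^-1 : R),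
    j%:R^-1 * (\sum_(k < N * j) reach_prob j%:R^-1 P clock B B' x k v) <= C0 + C1 / j%:R &
    (P (collision j%:R^-1 clock B B' (N * j)) <= (C1 / j%:R)%:E)%E ] ].
Proof.
have [B' uW dir] := exists_finite_dirichlet (c_cond (lexx 0)) c0_trans uB.
set W := B ++ B'.
(* The sum over y stands in for a maximum: it bounds the rate from any vertex of W into W, at all
   times. *)
pose Lambda : R := \sum_(y <- W) \sum_(z <- W) cinf y z.
pose L : R := \sum_(e <- edges W) cinf e.1 e.2.
have Lambda0 : 0 <= Lambda.
  by apply: sumr_ge0 => y _; apply: sumr_ge0 => z _; exact: cinf_ge0.
(* With h = 1/j and N j cells, the error h (h Lambda)^2 (N j)^2 |W| of [energy_bound] is h times the
   first summand, and the collision bound N j 2 (h L)^2 is h times the second. *)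
pose C1 : R := Lambda ^+ 2 * (N ^ 2 * size W)%:R + N%:R * 2 * L ^+ 2.
have C11 : 0 <= Lambda ^+ 2 * (N ^ 2 * size W)%:R by rewrite mulr_ge0 ?sqr_ge0.
have C12 : 0 <= N%:R * 2 * L ^+ 2 by rewrite mulr_ge0 ?sqr_ge0 // mulr_ge0.
exists B', C1; split => //; first exact: addr_ge0.
(* From here on h Lambda <= 1, the stability condition of the recursion. *)
exists (Num.truncn Lambda).+1 => // j /= Lj.
have j0 : 0 < j%:R :> R by rewrite ltr0n; apply: leq_trans Lj.
pose h : R := j%:R^-1; have h0 : 0 < h by rewrite invr_gt0.
have hj : h * j%:R = 1 by rewrite mulVf // gt_eqF.
have hL : h * Lambda <= 1.
  rewrite mulrC ler_pdivrMr // mul1r; apply: ltW.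
  by apply: lt_le_trans (truncnS_gt _) _; rewrite ler_nat.
have sumW k z : z \in W -> \sum_(y <- W) mass c h k z y <= h * Lambda.
  move=> zW; apply: (@le_trans _ _ (\sum_(y <- W) h * cinf z y)).
    by apply: ler_sum => y _; exact: mass_le_lim.
  rewrite -mulr_sumr ler_pM2l // [leRHS](bigD1_seq z) //= lerDl.
  by apply: sumr_ge0 => y _; apply: sumr_ge0 => y' _; exact: cinf_ge0.
have m0 := mass_ge0 c_cond c_ndecr h0.
have sumW' k z : z \in W -> \sum_(y <- W | y != z) mass c h k z y <= h * Lambda.
  move=> zW; apply: le_trans (sumW k z zW); rewrite big_mkcond.
  by apply: ler_sum => y _; case: ifP.
have sumE k : \sum_(e <- edges W) mass c h k e.1 e.2 <= h * L.
  by rewrite mulr_sumr; apply: ler_sum => e _; exact: mass_le_lim.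
have u01 := reach_prob_ge0_le1 h0 clocks B B' x.
split => //.
  have := @energy_bound R V B B' (c 0) (resistance (c 0) x) (resistance (c 0) v) h
    ((h * Lambda) ^+ 2) x v (mass c h) (reach_prob h P clock B B' x) (N * j) uW xB.
  move=> eb; apply: le_trans (eb _ _ _ _ _ _ _ _ _ _ _ _ _ _) _ => //.
  - exact: (resistance_gt0 (c_cond (lexx 0)) c0_trans).
  - exact: (resistance_gt0 (c_cond (lexx 0)) c0_trans).
  - exact: sqr_ge0.
  - by move=> f f0; split; exact: dir.
  - exact: mass_sym.
  - by move=> k z zW; apply: le_trans hL; exact: sumW.
  - by move=> k y z; exact: mass_homo.
  - move=> y z; have := mass_ge c_cond c_ndecr h0 0 y z.
    by rewrite /grid mul0r.
  - by move=> k z zB; rewrite /reach_prob (negbTE zB).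
  - by move=> z; apply: reach_prob0.
  - by move=> k z zB; apply: (reach_probS c_cond c_ndecr h0 clocks uW sumW' hL x k zB).
  rewrite -/C0 lerD2l -/h.
  have -> : h * (h * Lambda) ^+ 2 * ((N * j) ^ 2 * size W)%:R =
      Lambda ^+ 2 * (N ^ 2 * size W)%:R * h * (h * j%:R) ^+ 2.
    by rewrite !natrM; ring.
  by rewrite hj expr1n mulr1 ler_pM2r // lerDl.
apply: (le_trans (prob_collision c_cond c_ndecr h0 clocks sumE _)).
rewrite lee_fin -/h.
have -> : (N * j)%:R * (2 * (h * L) ^+ 2) = N%:R * 2 * L ^+ 2 * h * (h * j%:R).
  by rewrite natrM; ring.
by rewrite hj mulr1 ler_pM2r // lerDr.
Qed.

End finite_domain.

Lemma exists_half_open_cell {R : realType} (h t : R) K : 0 <= t < grid h K ->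
  exists2 k, (k < K)%N & grid h k <= t < grid h k.+1.
Proof.
elim: K => [|n IH] /andP[t0 tK]; first by move: (le_lt_trans t0 tK); rewrite /grid mul0r ltxx.
have [nt|tn] := leP (grid h n) t; first by exists n; rewrite ?nt.
have [|k kn kP] := IH; first by rewrite t0.
by exists k => //; exact: ltnW.
Qed.

(** * Departures and occupation time in a finite set *)

Section expected_times.
Context {R : realType} {V : countType} (c : R -> V -> V -> R) (cinf : V -> V -> R).
Hypothesis c_cond : forall t, 0 <= t -> conductances (c t).
Hypothesis c_ndecr : forall s t u v, 0 <= s -> s <= t -> c s u v <= c t u v.
Hypothesis c_lim : forall u v, c t u v @[t --> +oo] --> cinf u v.
Hypothesis cinf_fin : forall v, (total_conductance cinf v < +oo)%E.
Hypothesis c0_trans : rw_transient (c 0).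
Context d (Omega : measurableType d) (P : probability Omega R).
Variables (x : V) (clock : V -> V -> Omega -> set R).
Hypothesis clocks : edge_clocks P c clock.
Variables (Y : nat -> Omega -> V) (T : nat -> Omega -> \bar R) (Z : set Omega).
Hypothesis mY : forall n v, measurable [set w | Y n w = v].
Hypothesis mT : forall n, measurable_fun [set: Omega] (T n).
Hypothesis mZ : measurable Z.
Hypothesis PZ : P Z = 0%E.
Hypothesis drv : forall w, ~ Z w ->
  driven_by (fun u v => clock u v w) x (Y ^~ w) (T ^~ w).

Definition stays (B : seq V) v n : set Omega :=
  [set w | Y n w = v /\ forall i, (i <= n)%N -> Y i w \in B].

Lemma measurable_stays B v n : measurable (stays B v n).
Proof.
have mB i : measurable [set w | Y i w \in B].
  rewrite (_ : [set w | Y i w \in B] = \big[setU/set0]_(y <- B) [set w | Y i w = y]).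
    by apply: bigsetU_measurable.
  rewrite -bigcup_seq; apply/seteqP; split => w /= => [wB|[y yB /= ->//]].
  by exists (Y i w).
rewrite (_ : stays B v n = [set w | Y n w = v] `&`
    \bigcap_(i in [set i | (i <= n)%N]) [set w | Y i w \in B]).
  by apply: measurableI => //; exact: bigcap_measurableType.
by apply/seteqP; split.
Qed.

(** Departures, not visits, because a departure shows as a ring at v. The destination must lie in B
    too, so that the edge is watched. *)
Definition departure (B : seq V) v (N n : nat) : set Omega :=
  [set w | [/\ Y n w = v, forall i, (i <= n.+1)%N -> Y i w \in B &
     (T n.+1 w <= N%:R%:E)%E]].

Lemma measurable_departure B v N n : measurable (departure B v N n).
Proof.
rewrite (_ : departure B v N n = stays B v n `&` [set w | Y n.+1 w \in B] `&`
    [set w | (T n.+1 w <= N%:R%:E)%E]).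
  apply: measurableI; last by rewrite -[X in measurable X]setTI; exact: emeasurable_fun_infty_c.
  apply: measurableI; first exact: measurable_stays.
  rewrite (_ : [set w | Y n.+1 w \in B] = \big[setU/set0]_(y <- B) [set w | Y n.+1 w = y]).
    by apply: bigsetU_measurable.
  rewrite -bigcup_seq; apply/seteqP; split => w /= => [wB|[y yB /= ->//]].
  by exists (Y n.+1 w).
apply/seteqP; split => w /=.
  move=> [Yn YB TN]; split=> //; split; last exact: YB.
  by split=> // i /leqW; exact: YB.
move=> [[[Yn YB] YnB] TN]; split=> // i.
by rewrite leq_eqVlt => /predU1P[->//|]; rewrite ltnS; exact: YB.
Qed.

(** A subset of the product space, so that its product measure is an expected time. *)
Definition occupied (B : seq V) v (N : nat) : set (Omega * R) :=
  [set p | 0 <= p.2 < N%:R /\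
    exists n, stays B v n p.1 /\ (T n p.1 <= p.2%:E < T n.+1 p.1)%E].

Lemma measurable_occupied B v N : measurable (occupied B v N).
Proof.
have mfst : measurable_fun [set: Omega * R] (@fst Omega R) by exact: measurable_fst.
have msnd : measurable_fun [set: Omega * R] (EFin \o @snd Omega R).
  by apply/measurable_EFinP; exact: measurable_snd.
have mTf n : measurable_fun [set: Omega * R] (T n \o fst).
  exact: measurableT_comp.
rewrite (_ : occupied B v N = (setT `*` `[0, N%:R[) `&`
  \bigcup_n (stays B v n `*` setT `&`
    ([set p | (T n p.1 <= p.2%:E)%E] `&` [set p | (p.2%:E < T n.+1 p.1)%E]))).
  apply: measurableI; first exact: measurableX.
  apply: bigcupT_measurable => n; apply: measurableI.
    by apply: measurableX => //; exact: measurable_stays.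
  apply: measurableI.
    rewrite -[X in measurable X]setTI.
    exact: (measurable_lee measurableT (mTf n) msnd).
  rewrite -[X in measurable X]setTI.
  exact: (measurable_lte measurableT msnd (mTf n.+1)).
apply/seteqP; split => -[w t] /=.
  move=> [tN [n [st /andP[Tt tT]]]]; split; first by rewrite in_itv /= tN.
  by exists n.
move=> [[_ tN] [n _ [[/= st _] [Tt tT]]]]; split; first by move: tN; rewrite in_itv.
by exists n; split=> //; rewrite Tt tT.
Qed.

Variable B : seq V.
Hypothesis uB : uniq B.
Hypothesis xB : x \in B.
Variables (v : V) (vB : v \in B).
Variable N : nat.

Let C0 := resistance (c 0) x + resistance (c 0) v.
Let pi_inf := fine (total_conductance cinf v).

Let pi_inf_ge0 : 0 <= pi_inf.
Proof.
apply: fine_ge0; apply: esum_ge0 => z _; rewrite lee_fin.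
exact: (cinf_ge0 c_cond c_ndecr c_lim).
Qed.

Section one_grid.
Variables (B' : seq V) (j : nat).
Hypothesis uW : uniq (B ++ B').
Hypothesis j0 : 0 < j%:R^-1 :> R.
Local Notation h := (j%:R^-1 : R).
Local Notation K := (N * j)%N.
Local Notation u := (reach_prob h P clock B B' x).

Let grid_end : grid h K = N%:R.
Proof. by rewrite /grid natrM mulfK // -invr_eq0 gt_eqF. Qed.

Let bad : set Omega := collision h clock B B' K `|` Z.

Let measurable_bad : measurable bad.
Proof. by apply: measurableU => //; exact: (measurable_collision j0 clocks). Qed.

Let prob_bad : (P bad <= P (collision h clock B B' K))%E.
Proof.
apply: le_trans (measureU2 _ _ _) _ => //.
  exact: (measurable_collision j0 clocks).
by rewrite [X in (_ + X <= _)%E]PZ adde0.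
Qed.

Let sum_mass k : \sum_(y <- B | y != v) mass c h k v y <= h * pi_inf.
Proof.
apply: (@le_trans _ _ (\sum_(y <- B) h * cinf v y)).
  rewrite big_mkcond; apply: ler_sum => y _.
  have := mass_le_lim c_cond c_ndecr c_lim k v y j0.
  have := mass_ge0 c_cond c_ndecr j0 k v y.
  by case: ifP => _ // m0 m1; exact: le_trans m1.
rewrite -mulr_sumr ler_pM2l //.
exact: (sum_cinf_le c_cond c_ndecr c_lim cinf_fin).
Qed.

Let BW y : y \in B -> y \in B ++ B'. Proof. by rewrite mem_cat => ->. Qed.

Let measurable_busy k y : y != v -> measurable (~` quiet h clock k v y).
Proof.
move=> yv; apply: measurableC; apply: (measurable_quiet j0 clocks).
by rewrite eq_sym.
Qed.

(** A departure in cell k requires [reach] at v and a ring in that cell, with probability at most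
    u_k(v) h pi_inf by independence. On the bad event the count is only bounded by M, so the sum
    over n stays finite until the mesh has tended to 0. *)
Lemma sum_departure_le M :
  (\sum_(n < M) P (departure B v N n) <=
   (pi_inf * (h * \sum_(k < K) u k v))%:E + M%:R%:E * P (collision h clock B B' K))%E.
Proof.
have mr k : measurable (reach h clock B B' x k v).
  exact: (measurable_reach j0 clocks).
pose G k := \big[setU/set0]_(y <- B | y != v)
  (reach h clock B B' x k v `&` ~` quiet h clock k v y).
have mG k : measurable (G k).
  by apply: bigsetU_measurable => y yv; apply: measurableI => //; exact: measurable_busy.
rewrite -integral_sum_indic; last exact: measurable_departure.
apply: le_trans (integral_le_events (a := 1) (b := M%:R) (K := K)
  (G := fun k => G k) (C := bad) _ _ _ _ _ _ _ _) _ => //.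
- apply: emeasurable_sum => n; apply/measurable_EFinP; apply: measurable_indic.
  exact: measurable_departure.
- by move=> w; apply: sume_ge0 => n _; rewrite lee_fin.
- move=> w; rewrite sumEFin lee_fin.
  have inE' (A : set Omega) : (w \in A) = `[< A w >].
    by apply/idP/asboolP; rewrite inE.
  have G0 : 0 <= \sum_(k < K) 1 * (\1_(G k) w : R).
    by apply: sumr_ge0 => k _; rewrite mul1r.
  have [wbad|wgood] := pselect (bad w).
    rewrite [X in _ + _ * X]indicE mem_set // mulr1.
    apply: ler_wpDl => //.
    rewrite -[M in leRHS]card_ord -sum1_card natr_sum; apply: ler_sum => n _.
    by rewrite indicE lern1 leq_b1.
  rewrite ler_wpDr ?mulr_ge0 //.
  have [ncol nZ] : ~ collision h clock B B' K w /\ ~ Z w.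
    by split=> ?; apply: wgood; [left|right].
  have := departures_le j0 clocks (drv nZ) ncol v M.
  rewrite -(ler_nat R) -!sum1_card !natr_sum.
  under eq_bigr do rewrite -[1%:R]/(1 : R).
  rewrite big_mkcond [leRHS]big_mkcond /= => dep.
  apply: le_trans (le_trans dep _).
    apply: ler_sum => n _; rewrite indicE inE' inE /departure /= grid_end.
    by case: asboolP.
  apply: ler_sum => k _; rewrite mul1r indicE inE' inE.
  case: asboolP => //; case: asboolP => // nG [y /andP[yB yv] rq].
  exfalso; apply: nG; rewrite /G -bigcup_seq_cond; exists y => //.
  by rewrite /= yB yv.
apply: leeD; last by apply: lee_wpmul2l.
rewrite mul1e (_ : pi_inf * _ = \sum_(k < K) u k v * (h * pi_inf)); last first.
  by rewrite -mulr_suml; ring.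
rewrite -sumEFin; apply: lee_sum => k _.
apply: le_trans (measure_bigsetU_le _ _) _.
  by move=> y _ yv; apply: measurableI => //; exact: measurable_busy.
apply: (@le_trans _ _ (\sum_(y <- B | y != v) (u k v * mass c h k v y)%:E)%E).
  rewrite big_seq_cond [leRHS]big_seq_cond; apply: lee_sum => y /andP[yB yv].
  rewrite EFinM -(reach_probE j0 clocks) //.
  apply: (past_busy j0 clocks (W := B ++ B')); rewrite ?BW 1?eq_sym //.
  exact: (past_reach clocks).
rewrite sumEFin lee_fin -mulr_sumr ler_wpM2l ?sum_mass //.
by case/andP: (reach_prob_ge0_le1 j0 clocks B B' x k v).
Qed.

(** The term [N%:R * pi_inf * h] accounts for arrivals in the middle of a cell; on the bad event the
    time is bounded by the horizon N. *)
Lemma occupied_le :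
  ((P \x lebesgue_measure)%E (occupied B v N) <=
   (h * \sum_(k < K) u k v + N%:R * pi_inf * h)%:E +
   N%:R%:E * P (collision h clock B B' K))%E.
Proof.
have mr k : measurable (reach h clock B B' x k v).
  exact: (measurable_reach j0 clocks).
pose G k := reach h clock B B' x k v `|`
  \big[setU/set0]_(y <- B | y != v) ~` quiet h clock k v y.
have mbusy k : measurable (\big[setU/set0]_(y <- B | y != v) ~` quiet h clock k v y).
  by apply: bigsetU_measurable => y yv; exact: measurable_busy.
have mG k : measurable (G k) by exact: measurableU.
have mS := measurable_occupied B v N.
rewrite /product_measure1.
apply: le_trans (integral_le_events (a := h) (b := N%:R) (K := K)
  (G := fun k => G k) (C := bad) _ _ _ _ _ _ _ _) _ => //.
- exact: (measurable_fun_xsection lebesgue_measure mS).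
- move=> w /=.
  have lebN : lebesgue_measure (`[0, N%:R[%classic : set R) = N%:R%:E.
    rewrite lebesgue_measure_itv /= lte_fin ltr0n; case: N => [|n] //=.
    by rewrite -EFinD oppr0 addr0.
  have G0 : 0 <= \sum_(k < K) h * (\1_(G k) w : R).
    by apply: sumr_ge0 => k _; rewrite mulr_ge0 // ltW.
  have mxs : measurable (xsection (occupied B v N) w) by exact: measurable_xsection.
  have [wbad|wgood] := pselect (bad w).
    rewrite [X in _ + _ * X]indicE mem_set // mulr1.
    apply: (@le_trans _ _ N%:R%:E); last by rewrite lee_fin lerDr.
    rewrite -lebN; apply: le_measure; rewrite ?inE //.
    by move=> t; rewrite /xsection /= inE => -[/= tN _]; rewrite in_itv.
  apply: (@le_trans _ _ (\sum_(k < K) h * \1_(G k) w)%:E); last first.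
    by rewrite lee_fin lerDl mulr_ge0.
  have [ncol nZ] : ~ collision h clock B B' K w /\ ~ Z w.
    by split=> ?; apply: wgood; [left|right].
  pose I k : set R := if `[< G k w >] then `[grid h k, grid h k.+1[%classic else set0.
  have mI k : measurable (I k) by rewrite /I; case: ifP => _ //; exact: measurable_itv.
  apply: (@le_trans _ _ (lebesgue_measure (\big[setU/set0]_(k < K) I k))).
    apply: le_measure; rewrite ?inE //; first by apply: bigsetU_measurable => k _; exact: mI.
    move=> t; rewrite /xsection /= inE => -[/= tN [n [[Yn YB] Tn]]].
    have [|k kK kt] := @exists_half_open_cell _ h t K; first by rewrite grid_end.
    rewrite -bigcup_mkord; exists k => //.
    rewrite /I asboolT; first by rewrite /= in_itv.
    have [rk|[y /andP[yB yv] nq]] := occupation_cover j0 clocks (drv nZ) ncol kK Yn YB Tn kt.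
      by left.
    right; rewrite -bigcup_seq_cond; exists y => //.
    by rewrite /= yB yv.
  apply: le_trans (measure_bigsetU_le _ _) _ => [k _ _|]; first exact: mI.
  rewrite -sumEFin; apply: lee_sum => k _; rewrite /I indicE.
  have -> : (w \in G k) = `[< G k w >] by apply/idP/asboolP; rewrite inE.
  case: asboolP => _; last by rewrite measure0 mulr0.
  have lebI : lebesgue_measure (`[grid h k, grid h k.+1[%classic : set R) = h%:E.
    by rewrite lebesgue_measure_itv /= lte_fin gridS ltrDl j0 -EFinB; congr EFin; lra.
  by rewrite mulr1 [leLHS]lebI.
apply: leeD; last by apply: lee_wpmul2l.
have PG k : (P (G k) <= (u k v + h * pi_inf)%:E)%E.
  apply: le_trans (measureU2 _ _ _) _ => //.
  rewrite EFinD; apply: leeD; first by rewrite [leLHS](reach_probE j0 clocks B' x k vB).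
  apply: le_trans (measure_bigsetU_le _ _) _.
    by move=> y _ yv; exact: measurable_busy.
  apply: (@le_trans _ _ (\sum_(y <- B | y != v) (mass c h k v y)%:E)%E); last first.
    by rewrite sumEFin lee_fin sum_mass.
  rewrite big_seq_cond [leRHS]big_seq_cond; apply: lee_sum => y /andP[yB yv].
  suff : (P (setT `&` ~` quiet h clock k v y) <= P setT * (mass c h k v y)%:E)%E.
    by rewrite setTI probability_setT mul1e.
  apply: (past_busy j0 clocks (W := B ++ B')); rewrite ?BW 1?eq_sym //.
  exact: (@measurableT _ (g_sigma_algebraType _)).
apply: (@le_trans _ _ (h%:E * (\sum_(k < K) (u k v + h * pi_inf))%:E)%E).
  apply: lee_wpmul2l; first by rewrite lee_fin ltW.
  by rewrite -sumEFin; apply: lee_sum.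
rewrite -EFinM lee_fin big_split /= mulrDr lerD2l sumr_const card_ord.
rewrite -(mulr_natl (h * pi_inf) K).
rewrite (_ : h * (K%:R * (h * pi_inf)) = N%:R * pi_inf * h * (j%:R * h)); last first.
  by rewrite natrM; ring.
by rewrite mulfV ?mulr1 // -invr_eq0 gt_eqF.
Qed.

End one_grid.

Lemma expected_departures_le M :
  (\sum_(n < M) P (departure B v N n) <= (pi_inf * C0)%:E)%E.
Proof.
have [B' [C1 [uW C10 near_j]]] := grid_estimate c_cond c_ndecr c_lim c0_trans clocks uB xB vB N.
apply: (@lee_harmonic _ _ _ (pi_inf * C1 + M%:R * C1)).
apply: filterS near_j => j [j0 hu hc].
apply: (le_trans (sum_departure_le B' j0 M)).
apply: (@le_trans _ _ ((pi_inf * (C0 + C1 / j%:R))%:E + M%:R%:E * (C1 / j%:R)%:E)%E).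
  apply: leeD; first by rewrite lee_fin ler_wpM2l.
  by apply: lee_wpmul2l; rewrite ?lee_fin.
by rewrite -EFinM -EFinD lee_fin; lra.
Qed.

Lemma expected_occupation_le :
  ((P \x lebesgue_measure)%E (occupied B v N) <= C0%:E)%E.
Proof.
have [B' [C1 [uW C10 near_j]]] := grid_estimate c_cond c_ndecr c_lim c0_trans clocks uB xB vB N.
apply: (@lee_harmonic _ _ _ (C1 + N%:R * pi_inf + N%:R * C1)).
apply: filterS near_j => j [j0 hu hc].
apply: (le_trans (occupied_le B' j0)).
apply: (@le_trans _ _ ((C0 + C1 / j%:R + N%:R * pi_inf / j%:R)%:E +
  N%:R%:E * (C1 / j%:R)%:E)%E).
  apply: leeD; first by rewrite lee_fin lerD2r.
  by apply: lee_wpmul2l; rewrite ?lee_fin.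
by rewrite -EFinM -EFinD lee_fin; lra.
Qed.

End expected_times.

(** The function equal to infinity on Z and 0 elsewhere has integral 0; added to g, it absorbs the
    exceptional set. *)
Lemma ge0_ae_le_integral_nomeas d (T : measurableType d) (R : realType)
    (mu : {measure set T -> \bar R}) (Z : set T) (f g : T -> \bar R) :
  measurable Z -> mu Z = 0%E -> measurable_fun [set: T] g ->
  (forall w, 0 <= f w)%E -> (forall w, 0 <= g w)%E ->
  (forall w, ~ Z w -> f w <= g w)%E ->
  (\int[mu]_w f w <= \int[mu]_w g w)%E.
Proof.
move=> mZ Z0 mg f0 g0 fg.
pose k w : \bar R := (+oo * (\1_Z w)%:E)%E.
have m1 : measurable_fun [set: T] (fun w => (\1_Z w)%:E : \bar R).
  by apply/measurable_EFinP; exact: measurable_indic.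
have k0 w : (0 <= k w)%E by rewrite mule_ge0 // lee_fin.
have mk : measurable_fun [set: T] k by apply: emeasurable_funM => //; exact: measurable_cst.
have ik : (\int[mu]_w k w = 0)%E.
  by rewrite ge0_integralZl // integral_indic // setIT Z0 mule0.
rewrite -[leRHS]adde0 -ik -ge0_integralD //.
apply: ge0_le_integral_nomeas => // w.
have [wZ|wZ] := pselect (Z w); last by rewrite (le_trans (fg w wZ)) // leeDl.
rewrite /k indicE mem_set // mule1 addey ?leey //.
by rewrite -ltNye (lt_le_trans _ (g0 w)).
Qed.

(** * Exhaustion of V by finite sets *)

Section exhaustion_of_V.
Context {V : countType} (x v : V).

(** Putting x and v in front makes them belong to every set, as the estimates in a finite set
    require. *)
Definition exhaustion N : seq V := undup (x :: v :: pmap choice.unpickle (iota 0 N)).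

Lemma exhaustion_uniq N : uniq (exhaustion N). Proof. exact: undup_uniq. Qed.

Lemma mem_exhaustion_start N : x \in exhaustion N.
Proof. by rewrite mem_undup mem_head. Qed.

Lemma mem_exhaustion_target N : v \in exhaustion N.
Proof. by rewrite mem_undup !inE eqxx orbT. Qed.

Lemma exhaustion_le m n y : (m <= n)%N -> y \in exhaustion m -> y \in exhaustion n.
Proof.
move=> mn; rewrite !mem_undup !inE => /orP[->//|/orP[->|]]; first by rewrite orbT.
rewrite !mem_pmap => /mapP[k]; rewrite mem_iota add0n => km yk.
apply/orP; right; apply/orP; right; apply/mapP; exists k => //.
by rewrite mem_iota (leq_trans _ mn).
Qed.

Lemma exists_exhaustion (y : nat -> V) n :
  exists N, forall i, (i <= n)%N -> y i \in exhaustion N.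
Proof.
exists (\max_(i < n.+1) (choice.pickle (y i)).+1) => i iN.
rewrite mem_undup !inE mem_pmap; apply/orP; right; apply/orP; right.
apply/mapP; exists (choice.pickle (y i)); last by rewrite choice.pickleK.
rewrite mem_iota add0n /=.
exact: (@leq_bigmax _ (fun i : 'I_n.+1 => (choice.pickle (y i)).+1)
  (Ordinal (iN : (i < n.+1)%N))).
Qed.

End exhaustion_of_V.

(** * Monotone limit in the finite set and the horizon *)

Section total_times.
Context {R : realType} {V : countType} (c : R -> V -> V -> R) (cinf : V -> V -> R).
Hypothesis c_cond : forall t, 0 <= t -> conductances (c t).
Hypothesis c_ndecr : forall s t u v, 0 <= s -> s <= t -> c s u v <= c t u v.
Hypothesis c_lim : forall u v, c t u v @[t --> +oo] --> cinf u v.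
Hypothesis cinf_fin : forall v, (total_conductance cinf v < +oo)%E.
Hypothesis c0_trans : rw_transient (c 0).
Context d (Omega : measurableType d) (P : probability Omega R).
Variables (x : V) (clock : V -> V -> Omega -> set R).
Hypothesis clocks : edge_clocks P c clock.
Variables (Y : nat -> Omega -> V) (T : nat -> Omega -> \bar R) (Z : set Omega).
Hypothesis mY : forall n v, measurable [set w | Y n w = v].
Hypothesis mT : forall n, measurable_fun [set: Omega] (T n).
Hypothesis mZ : measurable Z.
Hypothesis PZ : P Z = 0%E.
Hypothesis drv : forall w, ~ Z w ->
  driven_by (fun u v => clock u v w) x (Y ^~ w) (T ^~ w).
Variable v : V.

Let resist := resistance (c 0) x + resistance (c 0) v.
Local Notation exhaustion := (exhaustion x v).

(** One index serves for the finite set and for the horizon, so that a single monotone limit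
    suffices. *)
Definition departs n : set Omega := \bigcup_N departure Y T (exhaustion N) v N n.

Let measurable_departs n : measurable (departs n).
Proof. by apply: bigcupT_measurable => N; exact: measurable_departure. Qed.

Lemma sum_departs_le M :
  (\sum_(n < M) P (departs n) <= (fine (total_conductance cinf v) * resist)%:E)%E.
Proof.
have cvg_dep : (\sum_(n < M) P (departure Y T (exhaustion N) v N n) @[N --> \oo] -->
    \sum_(n < M) P (departs n))%E.
  apply: cvg_nnesum => n _; first by apply: nearW => N; exact: measure_ge0.
  apply: nondecreasing_cvg_mu.
  - by move=> N; exact: measurable_departure.
  - exact: measurable_departs.
  move=> m N mN; apply/subsetPset => w [Yn YB TN]; split => //.
    by move=> i iN; apply: (exhaustion_le mN); exact: YB.
  by apply: (le_trans TN); rewrite lee_fin ler_nat.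
apply: (cvge_to_le cvg_dep); apply: nearW => N.
exact: (expected_departures_le c_cond c_ndecr c_lim cinf_fin c0_trans clocks
  mY mT mZ PZ drv (exhaustion_uniq x v N)
  (mem_exhaustion_start x v N) (mem_exhaustion_target x v N)).
Qed.

Lemma departsP n w : Y n w = v -> (T n.+1 w < +oo)%E -> departs n w.
Proof.
move=> Yn Tn; have [N1 YB] := exists_exhaustion x v (Y ^~ w) n.+1.
pose N2 := (Num.truncn (fine (T n.+1 w))).+1.
exists (maxn N1 N2) => //; split => //.
  by move=> i iN; apply: (exhaustion_le (leq_maxl N1 N2)); exact: YB.
apply: (@le_trans _ _ N2%:R%:E); last by rewrite lee_fin ler_nat leq_maxr.
case: (T n.+1 w) Tn @N2 => [r _|//|_] N2; last exact: leNye.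
by rewrite lee_fin ltW // truncnS_gt.
Qed.

(** Every visit ends with a jump, except possibly the one after which no jump occurs; it accounts
    for the 1. *)
Lemma nb_visits_le w : ~ Z w ->
  (nb_visits (Y ^~ w) (T ^~ w) v <= 1 + \sum_(n <oo) (\1_(departs n) w)%:E)%E.
Proof.
move=> /drv dw; rewrite /nb_visits counting_dirac.
pose last_jump : set nat := [set n | (T n w < +oo)%E /\ T n.+1 w = +oo%E].
have last_uniq m n : last_jump m -> last_jump n -> m = n.
  move=> [Tm Tm1] [Tn Tn1]; have [mn|nm|//] := ltngtP m n; exfalso.
    by have := jump_time_le dw mn; rewrite Tm1 leye_eq => /eqP Tn'; rewrite Tn' in Tn.
  by have := jump_time_le dw nm; rewrite Tn1 leye_eq => /eqP Tm'; rewrite Tm' in Tm.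
have count_last : (counting last_jump <= 1 :> \bar R)%E.
  have [[n ln]|none] := pselect (exists n, last_jump n).
    have -> : last_jump = [set n].
      by apply/seteqP; split => m /=; [move/last_uniq; exact|move=> ->].
    by rewrite /counting asboolT ?fset_set1 ?cardfs1.
  have -> : last_jump = set0 by apply/seteqP; split => // n ln; apply: none; exists n.
  by rewrite /counting asboolT ?fset_set0 ?cardfs0 // lee_fin.
rewrite counting_dirac in count_last.
apply: (@le_trans _ _ (\sum_(n <oo) (\d_n last_jump + (\1_(departs n) w)%:E))%E).
  apply: lee_nneseries => [//|n _].
  rewrite !diracE indicE.
  have [nS|] := boolP (n \in _); last by move=> _; rewrite adde_ge0 // lee_fin.
  move: nS; rewrite inE => -[Tn Yn].
  have Tfin : (T n w < +oo)%E by apply: (lt_le_trans Tn); exact: leey.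
  have [Tn1|Tn1] := ltP (T n.+1 w) +oo%E.
    by rewrite (mem_set (A := departs n)) ?leeDr ?lee_fin //; exact: departsP.
  rewrite (mem_set (A := last_jump)) ?leeDl ?lee_fin //.
  by split => //; apply/eqP; rewrite -leye_eq.
rewrite nneseriesD //.
by rewrite leeD2r.
Qed.

Lemma expected_nb_visits_lty : (\int[P]_w nb_visits (Y ^~ w) (T ^~ w) v < +oo)%E.
Proof.
have m1 n : measurable_fun [set: Omega] (fun w => (\1_(departs n) w)%:E : \bar R).
  by apply/measurable_EFinP; exact: measurable_indic.
have ms : measurable_fun [set: Omega] (fun w => \sum_(n <oo) (\1_(departs n) w)%:E : \bar R)%E.
  by apply: ge0_emeasurable_sum => // n w _ _; rewrite lee_fin.
have s0 w : (0 <= \sum_(n <oo) (\1_(departs n) w)%:E :> \bar R)%E.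
  by apply: nneseries_ge0 => n _ _; rewrite lee_fin.
apply: (@le_lt_trans _ _ (\int[P]_w (1 + \sum_(n <oo) (\1_(departs n) w)%:E))%E).
  apply: (ge0_ae_le_integral_nomeas mZ PZ).
  - by apply: emeasurable_funD => //; exact: measurable_cst.
  - by move=> w; rewrite /nb_visits counting_dirac; exact: nneseries_ge0.
  - by move=> w; rewrite adde_ge0.
  - exact: nb_visits_le.
have i1 : (\int[P]_w (1 : \bar R) = 1)%E.
  by rewrite integral_cst // mul1e; exact: probability_setT.
rewrite ge0_integralD // i1.
rewrite integral_nneseries //.
apply: (@le_lt_trans _ _ (1 + (fine (total_conductance cinf v) * resist)%:E)%E).
  apply: leeD2l; apply: lime_le.
    by apply: is_cvg_nneseries => n _ _; exact: integral_ge0.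
  apply: nearW => M; rewrite big_mkord.
  under eq_bigr do rewrite integral_indic // setIT.
  exact: sum_departs_le.
by rewrite -EFinD ltry.
Qed.

Let occ : set (Omega * R) := \bigcup_N occupied Y T (exhaustion N) v N.

Let measurable_occ : measurable occ.
Proof. by apply: bigcupT_measurable => N; exact: measurable_occupied. Qed.

Lemma occ_le : ((P \x lebesgue_measure)%E occ <= resist%:E)%E.
Proof.
have cvg_occ :
    ((P \x lebesgue_measure)%E \o (fun N => occupied Y T (exhaustion N) v N)) @ \oo -->
    (P \x lebesgue_measure)%E occ.
  apply: nondecreasing_cvg_mu => //.
    by move=> N; exact: measurable_occupied.
  move=> m N mN; apply/subsetPset => -[w t] [/= /andP[t0 tm] [n [[Yn YB] Tn]]].
  split => /=; first by rewrite t0 (lt_le_trans tm) // ler_nat.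
  by exists n; split => //; split => // i /YB; exact: exhaustion_le.
apply: (cvge_to_le cvg_occ); apply: nearW => N.
exact: (expected_occupation_le c_cond c_ndecr c_lim cinf_fin c0_trans clocks
  mY mT mZ PZ drv (exhaustion_uniq x v N)
  (mem_exhaustion_start x v N) (mem_exhaustion_target x v N)).
Qed.

Lemma local_time_le w :
  (local_time (Y ^~ w) (T ^~ w) v <= lebesgue_measure (xsection occ w))%E.
Proof.
have mx : measurable (xsection occ w) by exact: measurable_xsection.
rewrite -[xsection occ w]setIT -integral_indic // /local_time [leLHS]integral_mkcond.
apply: ge0_le_integral_nomeas => t; rewrite patchE.
  by case: ifP => // _; rewrite lee_fin.
case: ifP => [|_]; last by rewrite lee_fin.
rewrite inE /= => /andP[t0 _].
rewrite lee_fin !indicE.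
have [pos|_] := boolP (t \in [set s | position (Y ^~ w) (T ^~ w) s = Some v]);
  last exact: ler0n.
rewrite mem_set //; move: pos; rewrite inE /= /position.
(* [xget] defaults to [None], so the value [Some v] comes from a genuine index n. *)
case: xgetP => // o _ [n [Tn ->]] [Yn].
have [N1 YB] := exists_exhaustion x v (Y ^~ w) n.
pose N2 := (Num.truncn t).+1.
rewrite /xsection /= inE; exists (maxn N1 N2) => //; split => /=.
  rewrite -lee_fin t0 (lt_le_trans (truncnS_gt t)) // ler_nat.
  exact: leq_maxr.
exists n; split => //; split => // i iN.
by apply: (exhaustion_le (leq_maxl N1 N2)); exact: YB.
Qed.

Lemma expected_local_time_lty : (\int[P]_w local_time (Y ^~ w) (T ^~ w) v < +oo)%E.
Proof.
apply: (@le_lt_trans _ _ ((P \x lebesgue_measure)%E occ)).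
  (* The product measure is by definition the integral over w of the measure of the section at w. *)
  apply: ge0_le_integral_nomeas => w; last exact: local_time_le.
  by apply: integral_ge0 => t _; rewrite lee_fin.
by apply: (le_lt_trans occ_le); rewrite ltry.
Qed.

End total_times.

Theorem theorem1p12 (R : realType) (V : countType)
  (c : R -> V -> V -> R) (cinf : V -> V -> R)
  (c_cond : forall t, 0 <= t -> conductances (c t))
  (c_ndecr : forall s t u v, 0 <= s -> s <= t -> c s u v <= c t u v)
  (c_lim : forall u v, c t u v @[t --> +oo] --> cinf u v)
  (cinf_fin : forall v, (total_conductance cinf v < +oo)%E)
  (c0_irr : rw_irreducible (c 0)) (c0_trans : rw_transient (c 0))
  (d : measure_display) (Omega : measurableType d) (P : probability Omega R)
  (x : V) (Y : nat -> Omega -> V) (T : nat -> Omega -> \bar R)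
  (walk : rw_changing_environment P c x Y T) (v : V) :
  (\int[P]_w nb_visits (Y ^~ w) (T ^~ w) v < +oo)%E /\
  (\int[P]_w local_time (Y ^~ w) (T ^~ w) v < +oo)%E.
Proof.
have [mY mT [clock [clocks [Z [mZ PZ notZ]]]]] := walk.
have drv w : ~ Z w -> driven_by (fun u v => clock u v w) x (Y ^~ w) (T ^~ w).
  by move=> nZ; apply: contrapT => /notZ.
split.
- exact: (expected_nb_visits_lty c_cond c_ndecr c_lim cinf_fin c0_trans clocks
    mY mT mZ PZ drv).
- exact: (expected_local_time_lty c_cond c_ndecr c_lim cinf_fin c0_trans clocks
    mY mT mZ PZ drv).
Qed.
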